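(* Let $W=\bigcap_{i\in[m]}W^i$, where $[m]=\{1,\dots,m\}$, $W^i=\{x\in\mathbb{R}^2 \mid A^ix\succeq_{\mathcal{L}^{m_i}}b^i\}$, $A^i\in\mathbb{R}^{m_i\times 2}$, $b^i\in\mathbb{R}^{m_i}$ and $\mathcal{L}^{m_i}$ is the second-order cone in $\mathbb{R}^{m_i}$. Assume $W$ has nonempty interior and each constraint $A^ix\succeq_{\mathcal{L}^{m_i}}b^i$ in the description of $W$ is either a half-space or a single conic section, such as a parabola, an ellipse, or one branch of a hyperbola. Also assume that if $W^i$ is a hyperbola, then it is non-degenerate and it is written with $A^i\in\mathbb{R}^{3\times 2}$ and $A^i_{11}=A^i_{12}=0$. Finally, assume that each $W^i$ is non-redundant, that is, for all $j\in[m]$, $W$ is strictly contained in $\bigcap_{i\in[m],\,i\neq j}W^i$. Then the following statements hold: 1. If $W\cap\mathbb{Z}^2=\emptyset$, then this fact can be certified with the application of at most two inequalities, each generated from a linear composition function or being one of the hyperbola cuts. 2. Assume $\operatorname{interior}(W)\cap\mathbb{Z}^2\neq\emptyset$. If $\pi^{\top}x\geq\pi_0$ defines a face of $W^I$, where $\pi\in\mathbb{Z}^2$ is non-zero, then this inequality can be obtained with application of exactly one linear composition function or it is one of the hyperbola cuts.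
   Context: $\mathcal{L}^k=\{x\in\mathbb{R}^k \mid \sqrt{x_1^2+\dots+x_{k-1}^2}\leq x_k\}$ is the second-order cone in $\mathbb{R}^k$. For a cone $K$, $u\succeq_K v$ means $u-v\in K$, and $K^*=\{y \mid y^{\top}x\geq 0\ \forall x\in K\}$ is the dual cone. ''Parabola'', ''ellipse'' and ''branch of a hyperbola'' refer to the curve as well as to the convex region delimited by it. For $X\subseteq\mathbb{R}^2$, $X^I$ is the integer hull of $X$, i.e. the convex hull of $X\cap\mathbb{Z}^2$. Linear composition functions. For a positive integer $p$, let $\mathcal{F}_{\mathbb{R}^p_+}$ be the set of functions $g:\mathbb{R}^p\to\mathbb{R}$ that are subadditive, non-decreasing with respect to the componentwise order, and satisfy $g(0)=0$. For a regular (pointed, closed, convex, full dimensional) cone $K\subseteq\mathbb{R}^M$, a linear composition function is a function $f:\mathbb{R}^M\to\mathbb{R}$ of the form $f(v)=g((w^1)^{\top}v,\dots,(w^p)^{\top}v)$, where $w^1,\dots,w^p\in K^*$ and $g\in\mathcal{F}_{\mathbb{R}^p_+}$ satisfies $g(u)=-g(-u)$ for all $u\in\mathbb{R}^p$. For a set $\{x\in\mathbb{R}^2 \mid Ax\succeq_K b\}$, where $A$ has columns $a^1,a^2$, it generates the inequality $f(a^1)x_1+f(a^2)x_2\geq f(b)$. Here $W$ is viewed as such a set by stacking its constraints, with $K=\mathcal{L}^{m_1}\times\dots\times\mathcal{L}^{m_m}$. Hyperbola cuts. For $\gamma\in\mathbb{R}^3$ define $f_\gamma:\mathbb{R}^3\to\mathbb{R}$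 by $f_\gamma(v)=\gamma^{\top}v+1$ if $v_1\neq 0$ and $\gamma^{\top}v\in\mathbb{Z}$, and $f_\gamma(v)=\lceil\gamma^{\top}v\rceil$ otherwise. Let $G=\{x\in\mathbb{R}^2 \mid Ax\succeq_{\mathcal{L}^3}b\}$ be one branch of a hyperbola with rational asymptotes, where $A\in\mathbb{R}^{3\times 2}$ has columns $a^1,a^2$ and $A_{11}=A_{12}=0$. Its asymptotes are $(A_{21}+A_{31})x_1+(A_{22}+A_{32})x_2=b_3+b_2$ and $(-A_{21}+A_{31})x_1+(-A_{22}+A_{32})x_2=b_3-b_2$; since they are rational, the coefficients of $x_1,x_2$ in these equations are assumed to be integers. Let $u^1=(0,1,1)$, $u^2=(0,-1,1)$, and for $j=1,2$ let $\tau^j=\gcd((u^j)^{\top}a^1,(u^j)^{\top}a^2)$ and $\gamma^j=u^j/\tau^j$. The hyperbola cuts for $G$ are the inequalities $(u^j)^{\top}a^1x_1+(u^j)^{\top}a^2x_2\geq\tau^jf_{\gamma^j}(b)$, $j=1,2$. In the theorem, the hyperbola cuts are those of the $W^i$ that are branches of hyperbolas.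
   Formalization: g(u) = −g(−u) is required only at the images u of the columns a^1, a^2 of A, not for all u (which forces g linear and makes the claim false); each rational asymptote gives a hyperbola cut even if the other is irrational; in part 2 hyperbola cuts are matched up to a positive factor. *)

(* Defs.v *)
From HB Require Import structures.
From mathcomp Require Import all_boot all_order all_algebra.
From mathcomp Require Import all_classical all_reals all_analysis.

Set Implicit Arguments.
Unset Strict Implicit.
Unset Printing Implicit Defensive.

Import Order.TTheory GRing.Theory Num.Theory.
Import numFieldNormedType.Exports.

Local Open Scope classical_set_scope.
Local Open Scope ring_scope.

Definition dotp (R : realType) (n : nat) (u v : 'cV[R]_n) : R :=
  (u^T *m v) 0 0.

Definition soc (R : realType) (n : nat) : set 'cV[R]_n.+1 :=
  [set x | Num.sqrt (\sum_(i < n) x (lift ord_max i) 0 ^+ 2) <= x ord_max 0].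

Definition dual_cone (R : realType) (n : nat) (K : set 'cV[R]_n) :
    set 'cV[R]_n :=
  [set y | forall x, K x -> 0 <= dotp y x].

Definition conic_set (R : realType) (n : nat) (K : set 'cV[R]_n)
    (A : 'M[R]_(n, 2)) (b : 'cV[R]_n) : set 'cV[R]_2 :=
  [set x | K (A *m x - b)].

Definition lattice (R : realType) : set 'cV[R]_2 :=
  [set x | exists z : 'cV[int]_2, x = map_mx intr z].

Definition conv_hull (R : realType) (X : set 'cV[R]_2) : set 'cV[R]_2 :=
  smallest (@convex_set R 'cV[R]_2) X.

Definition integer_hull (R : realType) (X : set 'cV[R]_2) : set 'cV[R]_2 :=
  conv_hull (X `&` @lattice R).

(* The pair c stands for the inequality c.1 x >= c.2. *)
Definition ineq (R : realType) : Type := ('cV[R]_2 * R)%type.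

Definition satisfies (R : realType) (c : ineq R) (x : 'cV[R]_2) : Prop :=
  c.2 <= dotp c.1 x.

(* Faces are nonempty; the improper face C is allowed. *)
Definition defines_face (R : realType) (C : set 'cV[R]_2) (c : ineq R) : Prop :=
  (forall x, C x -> satisfies c x) /\ exists2 x, C x & dotp c.1 x = c.2.

Definition half_space (R : realType) (G : set 'cV[R]_2) : Prop :=
  exists2 c : ineq R, c.1 != 0 & G = satisfies c.

Definition affinely_equivalent (R : realType) (C G : set 'cV[R]_2) : Prop :=
  exists2 T : 'M[R]_2, T \in unitmx &
    exists s : 'cV[R]_2, G = [set x | C (T *m x + s)].

Definition ellipse (R : realType) : set 'cV[R]_2 -> Prop :=
  affinely_equivalent [set y | y 0 0 ^+ 2 + y 1 0 ^+ 2 <= 1].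

Definition parabola (R : realType) : set 'cV[R]_2 -> Prop :=
  affinely_equivalent [set y | y 0 0 ^+ 2 <= y 1 0].

Definition nondegenerate_hyperbola_branch (R : realType) :
    set 'cV[R]_2 -> Prop :=
  affinely_equivalent [set y | Num.sqrt (y 0 0 ^+ 2 + 1) <= y 1 0].

(* The branch of a pair of crossing lines. *)
Definition degenerate_hyperbola_branch (R : realType) :
    set 'cV[R]_2 -> Prop :=
  affinely_equivalent [set y | `|y 0 0| <= y 1 0].

Definition hyperbola_branch (R : realType) (G : set 'cV[R]_2) : Prop :=
  nondegenerate_hyperbola_branch G \/ degenerate_hyperbola_branch G.

(* The regions bounded by the curve.  A strip (two parallel lines) is not a
   section of a cone and is not included. *)
Definition conic_section (R : realType) (G : set 'cV[R]_2) : Prop :=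
  [\/ parabola G, ellipse G | hyperbola_branch G].

Definition subadditive_map (R : realType) (p : nat) (g : 'cV[R]_p -> R) : Prop :=
  forall u v, g (u + v) <= g u + g v.

Definition componentwise_nondecreasing (R : realType) (p : nat) (g : 'cV[R]_p -> R) :
    Prop :=
  forall u v : 'cV[R]_p, (forall i, u i 0 <= v i 0) -> g u <= g v.

Definition cut_generating (R : realType) (p : nat) (g : 'cV[R]_p -> R) : Prop :=
  [/\ subadditive_map g, componentwise_nondecreasing g & g 0 = 0].

(* The oddness g(u) = - g(-u) is what makes the generated inequality valid for
   integer variables of arbitrary sign, and it is needed (and imposed) at the
   images u of the columns of A.  Imposing it at every u would leave only
   linear g: odd and subadditive imply additive, which with monotonicity gives
   linear; in particular the ceiling function would be excluded. *)
Definition linear_composition (R : realType) (M : nat) (K : set 'cV[R]_M)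
    (A : 'M[R]_(M, 2)) (f : 'cV[R]_M -> R) : Prop :=
  exists (p : nat) (w : 'I_p -> 'cV[R]_M) (g : 'cV[R]_p -> R),
    let image (v : 'cV[R]_M) := \col_l dotp (w l) v in
    [/\ (0 < p)%N,
        forall l, dual_cone K (w l),
        cut_generating g,
        forall j : 'I_2, g (image (col j A)) = - g (- image (col j A)) &
        forall v, f v = g (image v)].

Definition generated_ineq (R : realType) (M : nat) (f : 'cV[R]_M -> R)
    (A : 'M[R]_(M, 2)) (b : 'cV[R]_M) : ineq R :=
  (\col_j f (col j A), f b).

Definition linear_composition_cut (R : realType) (M : nat) (K : set 'cV[R]_M)
    (A : 'M[R]_(M, 2)) (b : 'cV[R]_M) (c : ineq R) : Prop :=
  exists2 f, linear_composition K A f & c = generated_ineq f A b.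

Definition f_gamma (R : realType) (gamma v : 'cV[R]_3) : R :=
  if (v 0 0 != 0) && (dotp gamma v \is a Num.int) then dotp gamma v + 1
  else (Num.ceil (dotp gamma v))%:~R.

(* (0, 1, 1) for j = 0 and (0, -1, 1) for j = 1. *)
Definition asymptote_dual (R : realType) (j : 'I_2) : 'cV[R]_3 :=
  \col_(i < 3) [:: 0; (-1) ^+ j; 1]`_i.

Definition asymptote_coef (R : realType) (A : 'M[R]_(3, 2)) (j : 'I_2) :
    'cV[R]_2 :=
  \col_l dotp (asymptote_dual R j) (col l A).

Definition integral_vec (R : realType) (c : 'cV[R]_2) : Prop :=
  exists z : 'cV[int]_2, c = map_mx intr z.

(* Parallel to an integer vector; only the slope of an asymptote matters. *)
Definition rational_direction (R : realType) (c : 'cV[R]_2) : Prop :=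
  exists (t : R) (z : 'cV[int]_2), c = t *: map_mx intr z.

Definition vec_gcd (z : 'cV[int]_2) : int := gcdz (z 0 0) (z 1 0).

(* The j-th cut involves the j-th asymptote only, and is available as soon as
   that asymptote has integer coefficients. *)
Definition hyperbola_cut (R : realType) (A : 'M[R]_(3, 2)) (b : 'cV[R]_3)
    (c : ineq R) : Prop :=
  exists (j : 'I_2) (z : 'cV[int]_2),
    let tau : R := (vec_gcd z)%:~R in
    asymptote_coef A j = map_mx intr z /\
    c = (asymptote_coef A j,
         tau * f_gamma (tau^-1 *: asymptote_dual R j) b).

(* The same inequality up to a positive factor. *)
Definition same_ineq (R : realType) (c d : ineq R) : Prop :=
  exists2 t : R, 0 < t & c = (t *: d.1, t * d.2).

(* Constraint i lives in dimension (k i).+1. *)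

Definition soc_prod (R : realType) (m : nat) (k : 'I_m -> nat) :
    set 'cV[R]_(\sum_i (k i).+1) :=
  [set v | forall i, soc (submxcol v i)].

Definition Wset (R : realType) (m : nat) (k : 'I_m -> nat)
    (A : forall i, 'M[R]_((k i).+1, 2)) (b : forall i, 'cV[R]_(k i).+1)
    (i : 'I_m) : set 'cV[R]_2 :=
  conic_set (@soc R (k i)) (A i) (b i).

(* The i-th block as a 3-row matrix; meaningful only when k i = 2. *)
Definition three_rows (R : realType) (n p : nat) (A : 'M[R]_(n, p)) :
    'M[R]_(3, p) :=
  conform_mx 0 A.

Definition system_lc_cut (R : realType) (m : nat) (k : 'I_m -> nat)
    (A : forall i, 'M[R]_((k i).+1, 2)) (b : forall i, 'cV[R]_(k i).+1) :
    ineq R -> Prop :=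
  linear_composition_cut (@soc_prod R m k) (\mxcol_i A i) (\mxcol_i b i).

Definition system_hyperbola_cut (R : realType) (m : nat) (k : 'I_m -> nat)
    (A : forall i, 'M[R]_((k i).+1, 2)) (b : forall i, 'cV[R]_(k i).+1)
    (c : ineq R) : Prop :=
  exists2 i, hyperbola_branch (Wset A b i) &
    hyperbola_cut (three_rows (A i)) (three_rows (b i)) c.

(* Main.v *)
Require Import Defs.
From HB Require Import structures.
From mathcomp Require Import all_boot all_order all_algebra.
From mathcomp Require Import all_classical all_reals all_analysis.
From mathcomp Require Import ring lra zify.

Set Implicit Arguments.
Unset Strict Implicit.
Unset Printing Implicit Defensive.

Import Order.TTheory GRing.Theory Num.Theory.
Import numFieldNormedType.Exports.

Local Open Scope classical_set_scope.
Local Open Scope ring_scope.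

(* Let C be the recession cone {r | A r in K}, and let (c, c0) be the inequality
   to be obtained.

   If c > 0 on C \ 0, finitely many dual vectors w_l cut off every integer point
   x with c x < c0, uniformly: compactness of the unit sphere deals with x far
   away, and the remaining x are finite in number.  With the w_l suitably scaled,
   g(u) = inf over integer x of c x + sum_l max(0, u_l - w_l A x) generates the
   inequality; g(A x) <= c x for integer x and subadditivity force
   g(A x) = c x, so g is odd at the columns of A.  For C = 0 the choice c = 0, c0 = 1
   certifies that W is lattice free.

   Otherwise c r = 0 for some r <> 0 in C.  Either W contains integer points near
   the ray spanned by r (Dirichlet), or r is rational; then every line
   c x = integer that meets W contains an integer point of W, and pushing far
   along r shows that inf c over W is inf c over a single W^i.  This W^i cannot
   be an ellipse or a parabola.  If it is a half-space, non-redundancy makes the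
   infimum attained and rounding up one multiplier suffices; if it is a
   hyperbola, c is normal to an asymptote, which the branch never reaches, and
   the hyperbola cut gives the next integer. *)

(** * Inner products and vectors of the plane *)

Section Dotp.
Variable R : realType.

Lemma dotpE n (u v : 'cV[R]_n) : dotp u v = \sum_i u i 0 * v i 0.
Proof. by rewrite /dotp mxE; apply: eq_bigr => i _; rewrite mxE. Qed.

Lemma dotpC n (u v : 'cV[R]_n) : dotp u v = dotp v u.
Proof. by rewrite !dotpE; apply: eq_bigr => i _; rewrite mulrC. Qed.

Lemma dotpDr n (u v w : 'cV[R]_n) : dotp u (v + w) = dotp u v + dotp u w.
Proof. by rewrite /dotp mulmxDr mxE. Qed.

Lemma dotpZr n a (u v : 'cV[R]_n) : dotp u (a *: v) = a * dotp u v.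
Proof. by rewrite /dotp -scalemxAr mxE. Qed.

Lemma dotpNr n (u v : 'cV[R]_n) : dotp u (- v) = - dotp u v.
Proof. by rewrite /dotp mulmxN mxE. Qed.

Lemma dotpBr n (u v w : 'cV[R]_n) : dotp u (v - w) = dotp u v - dotp u w.
Proof. by rewrite dotpDr dotpNr. Qed.

Lemma dotp0r n (u : 'cV[R]_n) : dotp u 0 = 0.
Proof. by rewrite /dotp mulmx0 mxE. Qed.

Lemma dotpDl n (u v w : 'cV[R]_n) : dotp (u + v) w = dotp u w + dotp v w.
Proof. by rewrite dotpC dotpDr !(dotpC w). Qed.

Lemma dotpZl n a (u v : 'cV[R]_n) : dotp (a *: u) v = a * dotp u v.
Proof. by rewrite dotpC dotpZr dotpC. Qed.

Lemma dotpNl n (u v : 'cV[R]_n) : dotp (- u) v = - dotp u v.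
Proof. by rewrite dotpC dotpNr dotpC. Qed.

Lemma dotp0l n (u : 'cV[R]_n) : dotp 0 u = 0.
Proof. by rewrite dotpC dotp0r. Qed.

Lemma dotp_mulmx n p (w : 'cV[R]_n) (A : 'M[R]_(n, p)) x :
  dotp w (A *m x) = dotp (A^T *m w) x.
Proof. by rewrite /dotp trmx_mul trmxK mulmxA. Qed.

Lemma dotp_col n p (w : 'cV[R]_n) (A : 'M[R]_(n, p)) j :
  dotp w (col j A) = (A^T *m w) j 0.
Proof. by rewrite dotpC /dotp tr_col -row_mul mxE. Qed.

Lemma dotp2 (u v : 'cV[R]_2) : dotp u v = u 0 0 * v 0 0 + u 1 0 * v 1 0.
Proof. by rewrite dotpE !big_ord_recl big_ord0 addr0; congr (_ + u _ 0 * v _ 0); exact: val_inj. Qed.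

Lemma cv2P (u v : 'cV[R]_2) : u 0 0 = v 0 0 -> u 1 0 = v 1 0 -> u = v.
Proof.
move=> e0 e1; apply/matrixP => i j; rewrite ord1.
by case: (unliftP 0 i) => [k ->|-> //]; rewrite ord1; have -> : lift 0 0 = 1 :> 'I_2 by exact: val_inj.
Qed.

Lemma cv2_neq0 (u : 'cV[R]_2) : u != 0 -> 0 < u 0 0 ^+ 2 + u 1 0 ^+ 2.
Proof.
move=> u0; rewrite lt_neqAle addr_ge0 ?sqr_ge0 // andbT eq_sym.
apply: contra u0; rewrite paddr_eq0 ?sqr_ge0 // !sqrf_eq0 => /andP[/eqP h0 /eqP h1].
by apply/eqP/cv2P; rewrite mxE.
Qed.

Definition vec2 (a b : R) : 'cV[R]_2 := \col_i (if i == 0 then a else b).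

Lemma vec2_0 a b : vec2 a b 0 0 = a. Proof. by rewrite mxE. Qed.
Lemma vec2_1 a b : vec2 a b 1 0 = b. Proof. by rewrite mxE. Qed.

End Dotp.

(** * Second-order cones, dual cones and products of cones *)

Section Duality.
Variable R : realType.

(** Cauchy-Schwarz. With [a] and [c] the two norms, the squares [(c * x i - a * y i) ^+ 2] have a
    nonnegative sum; expanding and dividing by [2 * a * c] gives the bound. Zero norms are treated
    first. *)
Lemma sum_mul_le_sqrt n (x y : 'I_n -> R) :
  \sum_i x i * y i <= Num.sqrt (\sum_i x i ^+ 2) * Num.sqrt (\sum_i y i ^+ 2).
Proof.
have H0 (z : 'I_n -> R) : 0 <= \sum_i z i ^+ 2 by apply: sumr_ge0 => i _; exact: sqr_ge0.
have Z (z t : 'I_n -> R) : \sum_i z i ^+ 2 = 0 -> \sum_i z i * t i = 0.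
  move=> /eqP; rewrite psumr_eq0 => [/allP h|i _]; last exact: sqr_ge0.
  apply: big1 => i _; have := h i (mem_index_enum i).
  by rewrite /= sqrf_eq0 => /eqP ->; rewrite mul0r.
have := H0 x; rewrite le_eqVlt => /predU1P[/esym hx|hx].
  by rewrite (Z _ _ hx) hx sqrtr0 mul0r.
have := H0 y; rewrite le_eqVlt => /predU1P[/esym hy|hy].
  under eq_bigr do rewrite mulrC.
  by rewrite (Z _ _ hy) hy sqrtr0 mulr0.
set a := Num.sqrt (\sum_i x i ^+ 2); set c := Num.sqrt (\sum_i y i ^+ 2).
have a0 : 0 < a by rewrite sqrtr_gt0.
have c0 : 0 < c by rewrite sqrtr_gt0.
have a2 : \sum_i x i ^+ 2 = a ^+ 2 by rewrite sqr_sqrtr // ltW.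
have c2 : \sum_i y i ^+ 2 = c ^+ 2 by rewrite sqr_sqrtr // ltW.
have : 0 <= \sum_i (c * x i - a * y i) ^+ 2 by apply: sumr_ge0 => i _; exact: sqr_ge0.
have -> : \sum_i (c * x i - a * y i) ^+ 2 =
    c ^+ 2 * \sum_i x i ^+ 2 + a ^+ 2 * \sum_i y i ^+ 2 - 2 * a * c * \sum_i x i * y i.
  rewrite !mulr_sumr -sumrN -!big_split /=; apply: eq_bigr => i _; ring.
rewrite a2 c2 => h; rewrite -(ler_pM2l (mulr_gt0 a0 c0)); lra.
Qed.

(* Closed convex cones, by the bipolar theorem. *)
Definition dually_closed n (K : set 'cV[R]_n) : Prop :=
  forall v, ~ K v -> exists2 w, dual_cone K w & dotp w v < 0.

(** If the last coordinate of [v] is negative, the last unit vector separates. Otherwise the last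
    coordinate lies in [[0, s)] with [s] the norm of the others, and negating those others and
    taking [s] as last coordinate separates: it is dual by Cauchy-Schwarz and has value
    [s * v ord_max 0 - s ^+ 2 < 0] at [v]. *)
Lemma soc_dually_closed n : dually_closed (@soc R n).
Proof.
move=> v /= /negP; rewrite -ltNge; set s := Num.sqrt _ => vs.
have [v0|v0] := ltP (v ord_max 0) 0.
  exists (delta_mx ord_max 0) => [x /= xs|].
    rewrite dotpE (bigD1 ord_max) //= big1 ?addr0 => [|i ne]; last by rewrite mxE (negPf ne) mul0r.
    rewrite mxE !eqxx mul1r; apply: le_trans xs; exact: sqrtr_ge0.
  rewrite dotpE (bigD1 ord_max) //= big1 ?addr0 => [|i ne]; last by rewrite mxE (negPf ne) mul0r.
  by rewrite mxE !eqxx mul1r.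
pose w : 'cV[R]_n.+1 := \col_i (if unlift ord_max i is Some _ then - v i 0 else s).
have wE (x : 'cV[R]_n.+1) : dotp w x =
    s * x ord_max 0 - \sum_(i < n) v (lift ord_max i) 0 * x (lift ord_max i) 0.
  rewrite dotpE (bigD1_ord ord_max) //= mxE unlift_none; congr (_ + _).
  by rewrite -sumrN; apply: eq_bigr => i _; rewrite mxE liftK mulNr.
have s0 : 0 < s by exact: le_lt_trans v0 vs.
have s2 : \sum_(i < n) v (lift ord_max i) 0 ^+ 2 = s ^+ 2.
  by rewrite sqr_sqrtr // sumr_ge0 // => i _; exact: sqr_ge0.
exists w => [x xs|]; rewrite wE.
  rewrite subr_ge0; apply: le_trans (sum_mul_le_sqrt _ _) _.
  by rewrite -/s ler_pM2l.
have -> : \sum_(i < n) v (lift ord_max i) 0 * v (lift ord_max i) 0 = s ^+ 2.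
  by rewrite -s2; apply: eq_bigr => i _; rewrite expr2.
nra.
Qed.

Lemma dual_coneZ n (K : set 'cV[R]_n) t w :
  0 <= t -> dual_cone K w -> dual_cone K (t *: w).
Proof. by move=> t0 Kw x Kx; rewrite dotpZl mulr_ge0 // Kw. Qed.

Lemma dual_cone0 n (K : set 'cV[R]_n) : dual_cone K 0.
Proof. by move=> x _; rewrite dotp0l. Qed.

Lemma dually_closedP n (K : set 'cV[R]_n) v : dually_closed K ->
  (forall w, dual_cone K w -> 0 <= dotp w v) -> K v.
Proof.
move=> sK h; apply: contrapT => /sK[w /h + wv].
by rewrite leNgt wv.
Qed.

Lemma dually_closedD n (K : set 'cV[R]_n) u v : dually_closed K -> K u -> K v -> K (u + v).
Proof.
by move=> sK Ku Kv; apply: dually_closedP => // w Kw; rewrite dotpDr addr_ge0 ?Kw.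
Qed.

Lemma dually_closedZ n (K : set 'cV[R]_n) t v : dually_closed K -> 0 <= t -> K v -> K (t *: v).
Proof.
by move=> sK t0 Kv; apply: dually_closedP => // w Kw; rewrite dotpZr mulr_ge0 ?Kw.
Qed.

Section ConicSet.
Variables (n : nat) (K : set 'cV[R]_n) (sK : dually_closed K).
Variables (A : 'M[R]_(n, 2)) (b : 'cV[R]_n).

Lemma conic_set_recession x r t :
  conic_set K A b x -> K (A *m r) -> 0 <= t -> conic_set K A b (x + t *: r).
Proof.
move=> Wx Kr t0; rewrite /conic_set /= mulmxDr -scalemxAr addrAC.
by apply: dually_closedD => //; apply: dually_closedZ.
Qed.

Lemma conic_set_convex x y t : conic_set K A b x -> conic_set K A b y ->
  0 <= t <= 1 -> conic_set K A b (x + t *: (y - x)).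
Proof.
move=> Wx Wy /andP[t0 t1]; rewrite /conic_set /=.
have -> : A *m (x + t *: (y - x)) - b = (1 - t) *: (A *m x - b) + t *: (A *m y - b).
  rewrite mulmxDr -scalemxAr mulmxBr !scalerBr !scalerBl !scale1r.
  by apply/matrixP => i j; rewrite !mxE; ring.
by apply: dually_closedD => //; apply: dually_closedZ => //; rewrite subr_ge0.
Qed.

Lemma conic_set_valid w x : dual_cone K w -> conic_set K A b x ->
  dotp w b <= dotp (A^T *m w) x.
Proof. by move=> Kw /Kw; rewrite dotpBr dotp_mulmx subr_ge0. Qed.

Lemma conic_set_cut x : ~ conic_set K A b x ->
  exists2 w, dual_cone K w & dotp (A^T *m w) x < dotp w b.
Proof.
by move=> /sK[w Kw]; rewrite dotpBr dotp_mulmx subr_lt0; exists w.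
Qed.

End ConicSet.

Section Product.
Variables (m : nat) (k : 'I_m -> nat).

(** Extension of [w] by zero outside block [i]: the transpose of the projection onto that block. *)
Definition block_vec (i : 'I_m) (w : 'cV[R]_(k i).+1) :
    'cV[R]_(\sum_i (k i).+1) := (submxcol 1%:M i)^T *m w.

Lemma dotp_block_vec i w v : dotp (@block_vec i w) v = dotp w (submxcol v i).
Proof.
by rewrite /block_vec -dotp_mulmx submxcol_mul mul1mx.
Qed.

Lemma block_vec_dual i w : dual_cone (@soc R (k i)) w ->
  dual_cone (@soc_prod R m k) (block_vec w).
Proof. by move=> Kw v Kv; rewrite dotp_block_vec Kw. Qed.

Lemma soc_prod_dually_closed : dually_closed (@soc_prod R m k).
Proof.
move=> v /existsNP[i /soc_dually_closed[w Kw wv]].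
by exists (block_vec w); [exact: block_vec_dual|rewrite dotp_block_vec].
Qed.

Variables (A : forall i, 'M[R]_((k i).+1, 2)) (b : forall i, 'cV[R]_(k i).+1).

Lemma block_vec_mxcol i w : (\mxcol_i A i)^T *m @block_vec i w = (A i)^T *m w.
Proof.
by rewrite /block_vec mulmxA -trmx_mul submxcol_mul mul1mx mxcolK.
Qed.

Lemma dotp_block_vec_mxcol i w : dotp (@block_vec i w) (\mxcol_i b i) = dotp w (b i).
Proof. by rewrite dotp_block_vec mxcolK. Qed.

Lemma Wset_prod x : (forall i, Wset A b i x) <->
  conic_set (@soc_prod R m k) (\mxcol_i A i) (\mxcol_i b i) x.
Proof.
by split=> h i; have := h i; rewrite /Wset /conic_set /= submxcolB -submxcol_mul !mxcolK.
Qed.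

Lemma soc_prod_mxcol x : soc_prod (\mxcol_i A i *m x) <-> forall i, soc (A i *m x).
Proof. by split=> h i; have := h i; rewrite -submxcol_mul mxcolK. Qed.

End Product.
End Duality.

(** * Integer points *)

Section Lattice.
Variable R : realType.
Implicit Types x y : 'cV[R]_2.

Lemma lattice0 : @lattice R 0.
Proof. by exists 0; rewrite map_mx0. Qed.

Lemma latticeD x y : lattice x -> lattice y -> lattice (x + y).
Proof. by move=> [u ->] [v ->]; exists (u + v); rewrite map_mxD. Qed.

Lemma latticeN x : lattice x -> lattice (- x).
Proof. by move=> [u ->]; exists (- u); rewrite map_mxN. Qed.

Lemma latticeZ (n : int) x : lattice x -> lattice (n%:~R *: x).
Proof. by move=> [u ->]; exists (n *: u); rewrite map_mxZ. Qed.

Lemma lattice_delta (j : 'I_2) : lattice (delta_mx j 0 : 'cV[R]_2).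
Proof. by exists (delta_mx j 0); rewrite map_delta_mx. Qed.

Lemma dotp_lattice_int (u : 'cV[int]_2) x : lattice x ->
  exists n : int, dotp (map_mx intr u) x = n%:~R.
Proof.
move=> [v ->]; exists (u 0 0 * v 0 0 + u 1 0 * v 1 0).
by rewrite dotp2 !mxE !rmorphD !rmorphM.
Qed.

Lemma int_box_finite (n : nat) : exists s : seq 'cV[int]_2,
  forall z : 'cV[int]_2, `|z 0 0| <= n%:Z -> `|z 1 0| <= n%:Z -> z \in s.
Proof.
pose r := [seq i%:Z - n%:Z | i <- iota 0 (n + n).+1].
have rP (a : int) : `|a| <= n%:Z -> a \in r.
  move=> an; apply/mapP; exists (absz (a + n%:Z)); last by lia.
  by rewrite mem_iota; lia.
exists [seq \col_i (if i == 0 then a else c) | a <- r, c <- r] => z h0 h1.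
apply/allpairsP; exists (z 0 0, z 1 0); split; rewrite /= ?rP //.
apply/matrixP => i j; rewrite ord1 mxE; case: (unliftP 0 i) => [l ->|->] //=.
by rewrite ord1; congr (z _ _); exact: val_inj.
Qed.

End Lattice.

(** * A cut-generating function as the value of a penalized integer program *)

Section ValueFunction.
Variables (R : realType) (M : nat) (K : set 'cV[R]_M) (A : 'M[R]_(M, 2)).
Variables (p : nat) (w : 'I_p -> 'cV[R]_M) (u : 'cV[int]_2).

Let obj (x : 'cV[R]_2) : R := dotp (map_mx intr u) x.

Let penalty (v : 'cV[R]_p) (x : 'cV[R]_2) : R :=
  \sum_l Num.max 0 (v l 0 - dotp (w l) (A *m x)).

(** Value function of the integer program with constraints [dotp (w l) (A *m x) >= v l 0], each of
    which may be violated at unit price. The infimum is a true one only because of [w_coercive]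
    below. *)
Definition penalized_value (v : 'cV[R]_p) : R :=
  inf [set obj x + penalty v x | x in @lattice R].

Hypothesis p_gt0 : (0 < p)%N.
Hypothesis w_dual : forall l, dual_cone K (w l).
Hypothesis w_coercive : forall x, lattice x ->
  0 <= obj x + \sum_l Num.max 0 (- dotp (w l) (A *m x)).

Let values v := [set obj x + penalty v x | x in @lattice R].

(** [w_coercive] is the case [v = 0], and since the positive part is 1-Lipschitz, passing to [v]
    lowers the penalty by at most the sum of the [|v l 0|]. *)
Let values_ge v : lbound (values v) (- \sum_l `|v l 0|).
Proof.
move=> _ [x xL <-]; have := w_coercive xL.
have : \sum_l Num.max 0 (- dotp (w l) (A *m x)) - \sum_l `|v l 0| <= penalty v x.
  rewrite -sumrN -big_split /=; apply: ler_sum => l _.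
  set t := dotp _ _; have := ler_norm (- v l 0); have := normr_ge0 (v l 0); rewrite normrN => h h'.
  have [h0|h0] := lerP 0 (- t); have [h1|h1] := lerP 0 (v l 0 - t); lra.
lra.
Qed.

Let values_inf v : has_inf (values v).
Proof.
split; last by exists (- \sum_l `|v l 0|); exact: values_ge.
by exists (obj 0 + penalty v 0), 0; first exact: lattice0.
Qed.

Lemma penalized_value_le v x : lattice x ->
  penalized_value v <= obj x + penalty v x.
Proof. by move=> xL; apply: ge_inf; [case: (values_inf v)|exists x]. Qed.

Lemma penalized_value_ge v c : (forall x, lattice x -> c <= obj x + penalty v x) ->
  c <= penalized_value v.
Proof.
move=> h; apply: lb_le_inf; first by case: (values_inf v).
by move=> _ [x xL <-]; exact: h.
Qed.

(** Subadditivity adds feasible points [x] and [y] of the two programs, the positive part being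
    subadditive. At [v = 0] the point [x = 0] gives the upper bound and coercivity the lower one. *)
Lemma penalized_value_cut_generating : cut_generating penalized_value.
Proof.
split=> [v v'|v v' vv'|].
- rewrite -inf_sumE; try exact: values_inf.
  apply: lb_le_inf.
    exists (obj 0 + penalty v 0 + (obj 0 + penalty v' 0)).
    by exists (obj 0 + penalty v 0); [exists 0; first exact: lattice0|
      exists (obj 0 + penalty v' 0); [exists 0; first exact: lattice0|]].
  move=> _ [_ [x xL <-] [_ [y yL <-] <-]].
  apply: le_trans (penalized_value_le _ (latticeD xL yL)) _.
  rewrite /obj dotpDr -!/(obj _) addrACA lerD2l -big_split /=.
  apply: ler_sum => l _; rewrite mulmxDr dotpDr mxE.
  set s := dotp _ _; set t := dotp _ _.
  have [h0|h0] := lerP 0 (v l 0 - s); have [h1|h1] := lerP 0 (v' l 0 - t);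
  have [h2|h2] := lerP 0 (v l 0 + v' l 0 - (s + t)); lra.
- apply: penalized_value_ge => x xL; apply: le_trans (penalized_value_le _ xL) _.
  rewrite lerD2l; apply: ler_sum => l _; have := vv' l.
  set s := dotp _ _; have [h0|h0] := lerP 0 (v l 0 - s);
  have [h1|h1] := lerP 0 (v' l 0 - s); lra.
- apply/eqP; rewrite eq_le; apply/andP; split.
    apply: le_trans (penalized_value_le 0 (@lattice0 R)) _.
    rewrite /obj dotp0r add0r /penalty big1 // => l _.
    by rewrite mulmx0 dotp0r subr0 mxE maxxx.
  apply: penalized_value_ge => x xL; apply: le_trans (w_coercive xL) _.
  by rewrite lerD2l; apply: ler_sum => l _; rewrite mxE sub0r.
Qed.

Let image (v : 'cV[R]_M) := \col_l dotp (w l) v.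

Let penalty_image x : penalty (image (A *m x)) x = 0.
Proof. by apply: big1 => l _; rewrite mxE subrr maxxx. Qed.

Let penalized_value_image (x : 'cV[R]_2) : lattice x ->
  penalized_value (image (A *m x)) = obj x.
Proof.
move=> xL; have [sub _ g0] := penalized_value_cut_generating.
have le y : lattice y -> penalized_value (image (A *m y)) <= obj y.
  by move=> yL; apply: le_trans (penalized_value_le _ yL) _; rewrite penalty_image addr0.
have := sub (image (A *m x)) (image (A *m - x)).
have -> : image (A *m x) + image (A *m - x) = 0.
  by apply/matrixP => i j; rewrite !mxE mulmxN dotpNr subrr.
have := le _ xL; have := le _ (latticeN xL).
rewrite g0 [obj (- x)]/obj dotpNr -/(obj _).
set g1 := penalized_value _; set g2 := penalized_value _ => h1 h2 h3; lra.
Qed.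

Lemma penalized_value_lc_cut b :
  linear_composition_cut K A b (map_mx intr u, penalized_value (image b)).
Proof.
have colE (j : 'I_2) : col j A = A *m delta_mx j 0 by rewrite colE.
exists (penalized_value \o image).
  exists p, w, penalized_value; split=> //; first exact: penalized_value_cut_generating.
  move=> j; rewrite -/(image _) colE.
  have -> : - image (A *m delta_mx j 0) = image (A *m - delta_mx j 0).
    by apply/matrixP => i l; rewrite !mxE mulmxN dotpNr.
  rewrite !penalized_value_image; [|exact/latticeN/lattice_delta|exact: lattice_delta].
  by rewrite /obj dotpNr opprK.
congr pair; apply/matrixP => j l; rewrite ord1 !mxE /= colE penalized_value_image.
  by rewrite /obj dotpE (bigD1 j) //= big1 ?addr0 ?mxE ?eqxx ?mulr1 // => i ij; rewrite [delta_mx _ _ _ _]mxE (negPf ij) mulr0.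
exact: lattice_delta.
Qed.

End ValueFunction.

(** * Finite families of linear functionals by compactness *)

Section Covering.
Variable R : realType.

(** One witness per list entry, as a family over an ordinal: the shape in which dual vectors enter a
    linear composition. *)
Lemma seq_witness (T : eqType) (U : Type) (s : seq T) (P : U -> Prop) (Q : T -> U -> Prop) :
  (forall x, x \in s -> exists2 y, P y & Q x y) ->
  exists l : nat, exists f : 'I_l -> U,
    (forall i, P (f i)) /\ forall x, x \in s -> exists i, Q x (f i).
Proof.
move=> h; pose g (i : 'I_(size s)) := cid2 (h _ (mem_tnth i (in_tuple s))).
exists (size s), (fun i => s2val (g i)); split=> [i|x xs]; first exact: s2valP (g i).
have i_lt : (index x s < size s)%N by rewrite index_mem.
exists (Ordinal i_lt); have := s2valP' (g (Ordinal i_lt)).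
by rewrite [X in Q X _](tnth_nth x) /= nth_index.
Qed.

(** Heine-Borel on [[-1, 1]]: each condition is open in [t], its left and right sides being a
    constant and an affine function of [t]. *)
Lemma segment_functional_cover (I : choiceType) (D : set I) (c : I -> 'cV[R]_2) (p q : 'cV[R]_2) :
  (forall t, -1 <= t <= 1 -> exists2 i, D i & 1 < dotp (c i) (p + t *: q)) ->
  exists s : seq I, (forall i, i \in s -> D i) /\
    forall t, -1 <= t <= 1 -> exists2 i, i \in s & 1 < dotp (c i) (p + t *: q).
Proof.
move=> h; have := @segment_compact R (-1) 1; rewrite compact_cover.
move=> /(_ I D (fun i => [set t | 1 < dotp (c i) (p + t *: q)]))[i Di||D' D'D cov].
- rewrite (_ : [set _ | _] = (fun t => dotp (c i) p + t * dotp (c i) q) @^-1` [set y | 1 < y]); last first.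
    by apply/seteqP; split => t /=; rewrite dotpDr dotpZr.
  apply: open_comp; last exact: open_gt.
  move=> t _; apply: (@cvgD _ R^o); first exact: cvg_cst.
  by apply: (@cvgM R); [exact: cvg_id|exact: cvg_cst].
- by move=> t /=; rewrite in_itv /= => /h[i Di]; exists i.
exists (finmap.enum_fset D'); split=> [i /D'D|t t1]; first by rewrite inE.
by have [|i /= iD'] := cov t; [rewrite /= in_itv|exists i].
Qed.

(** The max norm is chosen because its unit sphere consists of four segments, so one-dimensional
    compactness suffices. *)
Definition maxnorm2 (x : 'cV[R]_2) : R := Num.max `|x 0 0| `|x 1 0|.

Lemma maxnorm2_ge0 x : 0 <= maxnorm2 x.
Proof. by rewrite le_max normr_ge0. Qed.

Lemma dotp_le_maxnorm2 (u x : 'cV[R]_2) :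
  `|dotp u x| <= (`|u 0 0| + `|u 1 0|) * maxnorm2 x.
Proof.
rewrite dotp2; apply: le_trans (ler_normD _ _) _; rewrite !normrM mulrDl.
by apply: lerD; rewrite ler_wpM2l ?normr_ge0 // le_max lexx ?orbT.
Qed.

(** Closure under positive scaling lets a functional positive at a point of the unit sphere exceed 1
    there. Compactness of the four sides leaves finitely many functionals, and homogeneity extends
    the bound from the sphere to all [x]. *)
Lemma functional_cover (I : choiceType) (D : set I) (c : I -> 'cV[R]_2) :
  (forall i (t : R), D i -> 0 < t -> exists2 j, D j & c j = t *: c i) ->
  (forall x, x != 0 -> exists2 i, D i & 0 < dotp (c i) x) ->
  exists s : seq I, (forall i, i \in s -> D i) /\
    forall x, x != 0 -> exists2 i, i \in s & maxnorm2 x < dotp (c i) x.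
Proof.
move=> scal pos.
have edge (p q : 'cV[R]_2) : (forall t, p + t *: q != 0) ->
    exists s : seq I, (forall i, i \in s -> D i) /\
      forall t, -1 <= t <= 1 -> exists2 i, i \in s & 1 < dotp (c i) (p + t *: q).
  move=> ne0; apply: segment_functional_cover => t _.
  have [i Di ci] := pos _ (ne0 t).
  (* The factor makes the value at this point equal to 2. *)
  have [||j Dj cj] := scal i (2 / dotp (c i) (p + t *: q)) => //.
    by rewrite divr_gt0.
  exists j => //; rewrite cj dotpZl mulfVK ?gt_eqF //; lra.
have ne0 (a b d e : R) j : vec2 a b j 0 != 0 -> vec2 d e j 0 = 0 ->
    forall t, vec2 a b + t *: vec2 d e != 0.
  move=> ab de t; apply: contra_neq ab => /matrixP/(_ j 0).
  by rewrite !mxE in de *; rewrite de mulr0 addr0.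
have [|s1 [sD1 s1P]] := edge (vec2 1 0) (vec2 0 1).
  by apply: (ne0 _ _ _ _ 0); rewrite vec2_0 ?oner_eq0.
have [|s2 [sD2 s2P]] := edge (vec2 (-1) 0) (vec2 0 1).
  by apply: (ne0 _ _ _ _ 0); rewrite vec2_0 ?oppr_eq0 ?oner_eq0.
have [|s3 [sD3 s3P]] := edge (vec2 0 1) (vec2 1 0).
  by apply: (ne0 _ _ _ _ 1); rewrite vec2_1 ?oner_eq0.
have [|s4 [sD4 s4P]] := edge (vec2 0 (-1)) (vec2 1 0).
  by apply: (ne0 _ _ _ _ 1); rewrite vec2_1 ?oppr_eq0 ?oner_eq0.
exists (s1 ++ s2 ++ s3 ++ s4); split=> [i|x x0].
  by rewrite !mem_cat => /or4P[/sD1|/sD2|/sD3|/sD4].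
have nx0 : 0 < maxnorm2 x.
  rewrite lt_max !normr_gt0 -negb_and; apply: contra x0 => /andP[/eqP h0 /eqP h1].
  by apply/eqP/cv2P; rewrite mxE.
have main (p q : 'cV[R]_2) (s : seq I) t :
    (forall t, -1 <= t <= 1 -> exists2 i, i \in s & 1 < dotp (c i) (p + t *: q)) ->
    `|t| <= maxnorm2 x -> x = maxnorm2 x *: p + t *: q ->
    exists2 i, i \in s & maxnorm2 x < dotp (c i) x.
  move=> sP tx xE; have [|i si ci] := sP (t / maxnorm2 x).
    by rewrite -ler_norml normrM normfV (gtr0_norm nx0) ler_pdivrMr // mul1r.
  exists i => //; have -> : dotp (c i) x = maxnorm2 x * dotp (c i) (p + (t / maxnorm2 x) *: q).
    by rewrite -dotpZr scalerDr scalerA mulrCA mulfV ?gt_eqF // mulr1 -xE.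
  by rewrite -[ltLHS]mulr1 ltr_pM2l.
have sub_s (s : seq I) : (forall i, i \in s -> i \in s1 ++ s2 ++ s3 ++ s4) ->
    (exists2 i, i \in s & maxnorm2 x < dotp (c i) x) ->
    exists2 i, i \in s1 ++ s2 ++ s3 ++ s4 & maxnorm2 x < dotp (c i) x.
  by move=> ss [i /ss]; exists i.
have n0 : `|x 0 0| <= maxnorm2 x by rewrite le_max lexx.
have n1 : `|x 1 0| <= maxnorm2 x by rewrite le_max lexx orbT.
have : maxnorm2 x = `|x 0 0| \/ maxnorm2 x = `|x 1 0|.
  by rewrite /maxnorm2; case: ltP; [right|left].
case=> nE.
- have [x00|x00] := lerP 0 (x 0 0).
    apply: (sub_s s1) => [i|]; first by rewrite !mem_cat => ->.
    apply: (main _ _ _ (x 1 0) s1P n1).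
    by apply: cv2P; rewrite !mxE nE (ger0_norm x00) /=; ring.
  apply: (sub_s s2) => [i|]; first by rewrite !mem_cat => ->; rewrite !orbT.
  apply: (main _ _ _ (x 1 0) s2P n1).
  by apply: cv2P; rewrite !mxE nE (ltr0_norm x00) /=; ring.
- have [x00|x00] := lerP 0 (x 1 0).
    apply: (sub_s s3) => [i|]; first by rewrite !mem_cat => ->; rewrite !orbT.
    apply: (main _ _ _ (x 0 0) s3P n0).
    by apply: cv2P; rewrite !mxE nE (ger0_norm x00) /=; ring.
  apply: (sub_s s4) => [i|]; first by rewrite !mem_cat => ->; rewrite !orbT.
  apply: (main _ _ _ (x 0 0) s4P n0).
  by apply: cv2P; rewrite !mxE nE (ltr0_norm x00) /=; ring.
Qed.

End Covering.

(** * Objectives positive on the recession cone *)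

Section PositiveObjective.
Variables (R : realType) (M : nat) (K : set 'cV[R]_M) (sK : dually_closed K).
Variables (A : 'M[R]_(M, 2)) (b : 'cV[R]_M).

Lemma ler_sum_term (q : nat) (F : 'I_q -> R) l : (forall i, 0 <= F i) -> F l <= \sum_i F i.
Proof. by move=> F0; rewrite (bigD1 l) //= lerDl sumr_ge0. Qed.

Lemma max0_ge0 (x : R) : 0 <= Num.max 0 x.
Proof. by rewrite le_max lexx. Qed.

Lemma max0Z (t x : R) : 0 <= t -> Num.max 0 (t * x) = t * Num.max 0 x.
Proof. by move=> t0; rewrite maxr_pMr // mulr0. Qed.

(* If the objective is positive on the nonzero recession directions, finitely
   many dual vectors bound the norm on each sublevel set of the objective. *)
Lemma dual_vectors_coercive (c : 'cV[R]_2) :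
  (forall r, K (A *m r) -> r != 0 -> 0 < dotp c r) ->
  exists (q : nat) (w : 'I_q -> 'cV[R]_M) (s : R),
    [/\ (0 < q)%N, forall l, dual_cone K (w l), 0 <= s &
        forall x, maxnorm2 x - s * Num.max 0 (dotp c x) <=
          \sum_l Num.max 0 (- dotp (w l) (A *m x))].
Proof.
move=> cpos.
(* The functionals are [a c - A^T w] with [a >= 0] and [w] dual. At [x] with [dotp c x > 0] the pair
   [(1, 0)] works; at any other nonzero [x] the vector [A *m x] is outside [K], and a separating [w]
   works with [a = 0]. The constant [s] will be the sum of the [a]. *)
have [|x x0|S [SD SP]] := @functional_cover R (R * 'cV[R]_M)%type
    [set i | 0 <= i.1 /\ dual_cone K i.2] (fun i => i.1 *: c - A^T *m i.2).
- move=> [a w] t [/= a0 Kw] t0; exists (t * a, t *: w) => /=.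
    by split; [rewrite mulr_ge0 // ltW|apply: dual_coneZ => //; exact: ltW].
  by rewrite scalerBr scalerA -scalemxAr.
- have [cx|cx] := ltP 0 (dotp c x).
    exists (1, 0); first by split => //=; exact: dual_cone0.
    by rewrite /= scale1r mulmx0 subr0.
  have /sK[w Kw wx] : ~ K (A *m x).
    by move=> Kx; have := cpos _ Kx x0; rewrite ltNge cx.
  exists (0, w) => //=; rewrite scale0r sub0r dotpNl -dotp_mulmx; lra.
pose t l := tnth (in_tuple S) l.
have tD l : 0 <= (t l).1 /\ dual_cone K (t l).2 by have := SD _ (mem_tnth l (in_tuple S)).
exists (size S), (fun l => (t l).2), (\sum_l (t l).1); split.
- have [|i] := SP (vec2 1 0); last by case: (S).
  by apply/eqP => /matrixP/(_ 0 0); rewrite vec2_0 mxE; apply/eqP; exact: oner_neq0.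
- by move=> l; case: (tD l).
- by apply: sumr_ge0 => l _; case: (tD l).
move=> x; have [->|x0] := eqVneq x 0.
  rewrite dotp0r maxxx mulr0 subr0 /maxnorm2 !mxE normr0 maxxx.
  by apply: sumr_ge0 => l _; exact: max0_ge0.
have [i iS] := SP _ x0; have /tnthP[l il] : i \in in_tuple S by [].
rewrite dotpDl dotpZl dotpNl -dotp_mulmx {}il -/(t l) => hx.
apply: le_trans (ler_sum_term l _); last by move=> j; exact: max0_ge0.
have := @ler_sum_term _ (fun l => (t l).1) l (fun j => (tD j).1).
have := (tD l).1; have := max0_ge0 (dotp c x).
have : dotp c x <= Num.max 0 (dotp c x) by rewrite le_max lexx orbT.
have : - dotp (t l).2 (A *m x) <= Num.max 0 (- dotp (t l).2 (A *m x)).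
  by rewrite le_max lexx orbT.
move: (Num.max 0 (dotp c x)) (Num.max 0 _) (\sum_l _) hx => a d e hx.
move=> h1 h2 h3 h4 h5; nra.
Qed.

(** Two groups of dual vectors make the penalty at least [c0 - dotp c x] at every integer point with
    smaller objective: a coercive group for points outside a box, and one vector for each of the
    finitely many integer points of the box outside the conic set. Points of the set pay no penalty,
    so the resulting bound [G] remains valid. *)
Lemma lc_cut_of_positive (u : 'cV[int]_2) (c0 : R) :
  let c : 'cV[R]_2 := map_mx intr u in
  (forall r, K (A *m r) -> r != 0 -> 0 < dotp c r) ->
  (forall x, lattice x -> conic_set K A b x -> c0 <= dotp c x) ->
  exists G, [/\ c0 <= G, linear_composition_cut K A b (c, G) &
    forall x, lattice x -> conic_set K A b x -> G <= dotp c x].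
Proof.
move=> c cpos cint.
have [q [w [s [q0 Kw s0 ws]]]] := dual_vectors_coercive cpos.
set P := `|c 0 0| + `|c 1 0|.
have P0 : 0 <= P by rewrite addr_ge0.
have cP x : - (P * maxnorm2 x) <= dotp c x.
  by have := dotp_le_maxnorm2 c x; rewrite ler_norml => /andP[].
pose B := \sum_l `|dotp (w l) b|.
have B0 : 0 <= B by apply: sumr_ge0.
(* Beyond [rad] the coercive penalty, at least [(P + 1) * (maxnorm2 x - s * |c0| - B)], exceeds
   [|c0| + P * maxnorm2 x], hence [c0 - dotp c x]. [B] accounts for the right-hand side [b]. *)
pose rad := `|c0| + (P + 1) * (s * `|c0| + B).
have [n rad_n] : exists n : nat, rad <= n%:R.
  exists (absz (Num.ceil rad)); apply: le_trans (ceil_ge _) _.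
  by rewrite pmulrn ler_int abszE ler_norm.
have [box boxP] := int_box_finite n.
pose bad := [seq z <- box | `[< ~ conic_set K A b (map_mx intr z) >]].
(* Largest possible gap [c0 - dotp c x] inside the box; each bad point gets a dual vector scaled so
   that its violation alone reaches [D]. *)
pose D := `|c0| + P * n%:R.
have D0 : 0 < D + 1 by rewrite ltr_wpDl // addr_ge0 // mulr_ge0.
have [z|q' [w' [Kw' w'P]]] := @seq_witness _ _ bad (dual_cone K)
    (fun z v => D <= dotp v b - dotp v (A *m (map_mx intr z : 'cV[R]_2))).
  rewrite mem_filter => /andP[/asboolP /(conic_set_cut sK)[v Kv vz] _].
  rewrite -dotp_mulmx -subr_gt0 in vz.
  exists (((D + 1) / (dotp v b - dotp v (A *m map_mx intr z))) *: v).
    by apply: dual_coneZ => //; rewrite divr_ge0 ?ltW.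
  by rewrite !dotpZl -mulrBr divfK ?gt_eqF // lerDl.
pose W (i : 'I_(q + q')) := match fintype.split i with inl l => (P + 1) *: w l | inr l => w' l end.
have sumW (F : 'cV[R]_M -> R) : \sum_i F (W i) = \sum_l F ((P + 1) *: w l) + \sum_l F (w' l).
  rewrite big_split_ord /=; congr (_ + _); apply: eq_bigr => l _; congr F.
    by rewrite /W -[lshift _ l]/(unsplit (inl l)) unsplitK.
  by rewrite /W -[rshift _ l]/(unsplit (inr l)) unsplitK.
have P1 : 0 <= P + 1 by lra.
have W_dual i : dual_cone K (W i).
  by rewrite /W; case: fintype.split => l //; exact: dual_coneZ.
(* Only [dotp c x < 0] matters; there the [s]-term vanishes, and the weight [P + 1] makes the
   penalty at least [P * maxnorm2 x], which dominates [- dotp c x]. *)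
have W_coercive x : lattice x -> 0 <= dotp c x + \sum_i Num.max 0 (- dotp (W i) (A *m x)).
  move=> _; rewrite (sumW (fun v => Num.max 0 (- dotp v (A *m x)))) /=.
  have : 0 <= \sum_l Num.max 0 (- dotp (w' l) (A *m x)).
    by apply: sumr_ge0 => l _; exact: max0_ge0.
  under eq_bigr do rewrite dotpZl -mulrN max0Z //.
  rewrite -mulr_sumr; have := ws x; have := cP x; have := maxnorm2_ge0 x.
  set S := \sum_l _; have S0 : 0 <= S by apply: sumr_ge0 => l _; exact: max0_ge0.
  set S' := \sum_l _.
  by have [h0|h0] := lerP 0 (dotp c x) => h1 h2 h3 h4; nra.
have q0' : (0 < q + q')%N by rewrite addn_gt0 q0.
have cutP := penalized_value_lc_cut q0' W_dual W_coercive b.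
eexists; split; last 2 first; first exact: cutP.
- move=> x xL Wx; apply: le_trans (penalized_value_le W_coercive _ xL) _.
  rewrite big1 ?addr0 // => l _; rewrite mxE; apply/max_idPl.
  by rewrite -dotpBr; have := W_dual l _ Wx; rewrite !dotpBr; lra.
apply: (penalized_value_ge W_coercive) => x xL.
under [X in _ + X]eq_bigr do rewrite mxE.
rewrite (sumW (fun v => Num.max 0 (dotp v b - dotp v (A *m x)))) /=.
set S := \sum_l _; set S' := \sum_l _.
have S0 : 0 <= S by apply: sumr_ge0 => l _; exact: max0_ge0.
have S'0 : 0 <= S' by apply: sumr_ge0 => l _; exact: max0_ge0.
have [cx|cx] := leP c0 (dotp c x); first by rewrite ler_wpDr ?addr_ge0.
have xW : ~ conic_set K A b x by move=> /(cint _ xL); rewrite leNgt cx.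
have [small|big] := leP (maxnorm2 x) n%:R.
  have [z zx] := xL.
  have [|l hl] := w'P z.
    rewrite mem_filter; apply/andP; split; first by apply/asboolP; rewrite -zx.
    move: small; rewrite ge_max zx !mxE -!intr_norm => /andP[h0 h1].
    by apply: boxP; rewrite -(ler_int R).
  have : D <= S'.
    apply: le_trans (ler_sum_term l _); last by move=> j; exact: max0_ge0.
    by rewrite zx le_max hl orbT.
  have := cP x; have := ler_norm c0; rewrite /D => h1 h2 h3.
  have : P * maxnorm2 x <= P * n%:R by rewrite ler_wpM2l.
  lra.
have S_ge : (P + 1) * (maxnorm2 x - s * `|c0| - B) <= S.
  rewrite /S; under eq_bigr do rewrite !dotpZl -mulrBr max0Z //.
  rewrite -mulr_sumr ler_wpM2l //.
  have h1 : Num.max 0 (dotp c x) <= `|c0|.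
    by rewrite ge_max normr_ge0 /= (le_trans (ltW cx)) // ler_norm.
  have h2 : s * Num.max 0 (dotp c x) <= s * `|c0| by rewrite ler_wpM2l.
  have h3 : \sum_l Num.max 0 (- dotp (w l) (A *m x)) - B <=
      \sum_l Num.max 0 (dotp (w l) b - dotp (w l) (A *m x)).
    rewrite -sumrN -big_split /=; apply: ler_sum => l _.
    have := ler_norm (- dotp (w l) b); have := normr_ge0 (dotp (w l) b); rewrite normrN.
    set e := dotp _ _; set t := dotp _ _ => h h'.
    by have [h0|h0] := lerP 0 (- t); have [h4|h4] := lerP 0 (e - t); lra.
  have := ws x; lra.
have := cP x; have := ler_norm c0; have : rad < maxnorm2 x by exact: le_lt_trans rad_n big.
rewrite /rad; move: S_ge S'0; move: (maxnorm2 x) (`|c0|) => v a h1 h2 h3 h4 h5.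
lra.
Qed.

End PositiveObjective.

(** * Diophantine approximation of rays by integer points *)

Section Approximation.
Variable R : realType.
Implicit Types r x : 'cV[R]_2.

(** A Euclidean step: from an integer vector [e] that is no multiple of [z], subtract the multiple
    of [z] given by rounding the quotient of the values to the nearest integer. The remainder is
    nonzero and has at most half the value of [z]. *)
Lemma halve_linear_form (f : 'cV[R]_2) (z : 'cV[int]_2) : z != 0 ->
  exists2 z' : 'cV[int]_2, z' != 0 &
    `|dotp f (map_mx intr z')| <= `|dotp f (map_mx intr z)| / 2.
Proof.
move=> z0; set t := dotp f (map_mx intr z).
have [t0|t0] := eqVneq t 0; first by exists z => //; rewrite -/t t0 normr0 mul0r.
have [e eP] : exists e : 'cV[int]_2, forall k : int, e != k *: z.
  have [z00|z00] := eqVneq (z 0 0) 0.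
    exists (delta_mx 0 0) => k; apply/eqP => /matrixP/(_ 0 0).
    by rewrite !mxE z00 mulr0.
  exists (delta_mx 1 0) => k; apply/eqP => h.
  have /matrixP/(_ 0 0) := h; have /matrixP/(_ 1 0) := h.
  rewrite !mxE /= => h1 /esym/eqP; rewrite mulf_eq0 (negPf z00) orbF => /eqP k0.
  by move: h1; rewrite k0 mul0r.
set d := dotp f (map_mx intr e).
exists (e - Num.floor (d / t + 2^-1) *: z); first by rewrite subr_eq0.
rewrite map_mxB map_mxZ dotpBr dotpZr -/t -/d.
have /andP[] := floor_itv (d / t + 2^-1); rewrite rmorphD /=.
set n := (Num.floor _)%:~R => h1 h2.
have -> : d - n * t = (d / t - n) * t by rewrite mulrBl divfK.
rewrite normrM mulrC ler_wpM2l // ler_norml; lra.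
Qed.

(** Repeated halving takes the place of the pigeonhole principle; [n >= a / e] steps suffice because
    [n < 2 ^ n]. *)
Lemma small_linear_form (f : 'cV[R]_2) (e : R) : 0 < e ->
  exists2 z : 'cV[int]_2, z != 0 & `|dotp f (map_mx intr z)| < e.
Proof.
move=> e0; set a := `|dotp f (map_mx intr (delta_mx 0 0))|.
have iter n : exists2 z : 'cV[int]_2, z != 0 &
    `|dotp f (map_mx intr z)| <= a / 2 ^+ n.
  elim: n => [|n [z z0 zn]].
    exists (delta_mx 0 0); last by rewrite expr0 divr1.
    by apply/eqP => /matrixP/(_ 0 0); rewrite !mxE.
  have [z' z'0 h] := halve_linear_form f z0; exists z' => //.
  by rewrite exprSr invfM mulrA; lra.
set n := absz (Num.ceil (a / e)).
have [z z0 zn] := iter n; exists z => //; apply: le_lt_trans zn _.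
have an : a / e <= n%:R.
  by apply: le_trans (ceil_ge _) _; rewrite pmulrn ler_int /n abszE ler_norm.
rewrite ltr_pdivrMr ?exprn_gt0 // mulrC -ltr_pdivrMr //; apply: le_lt_trans an _.
by rewrite -natrX ltr_nat ltn_expl.
Qed.

(** The determinant of [r] and [x]. Up to the common factor [|r|], it is the signed distance of [x]
    from the line spanned by [r], while [dotp r x] is the progress along [r]. *)
Definition cross r x : R := r 0 0 * x 1 0 - r 1 0 * x 0 0.

(** Lagrange's identity in the plane. *)
Lemma sqr_cross_dotp r x : cross r x ^+ 2 + dotp r x ^+ 2 = dotp r r * dotp x x.
Proof. by rewrite /cross !dotp2; ring. Qed.

Lemma dotp_self_gt0 x : x != 0 -> 0 < dotp x x.
Proof. by move=> /cv2_neq0; rewrite dotp2 -!expr2. Qed.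

Lemma cross_decomposition r x :
  dotp r r *: x = dotp r x *: r + cross r x *: vec2 (- r 1 0) (r 0 0).
Proof. by rewrite /cross !dotp2; apply: cv2P; rewrite !mxE /=; ring. Qed.

(** A nonzero integer [x] has length at least 1, so if [cross r x] is tiny, Lagrange's identity
    keeps [dotp r x] away from 0. The multiple [K] pushes it past [L], and a choice of sign makes it
    point along [r]. *)
Lemma lattice_near_ray r (e L : R) : r != 0 -> 0 < e ->
  exists z, [/\ @lattice R z, `|cross r z| < e & L <= dotp r z].
Proof.
move=> /dotp_self_gt0; set q := dotp r r => q0 e0.
set K : nat := (absz (Num.ceil (4 * L ^+ 2 / q))).+1.
have K1 : 1 <= K%:R :> R by rewrite ler1n.
have KL : 4 * L ^+ 2 <= K%:R * q.
  rewrite -ler_pdivrMr //; apply: le_trans (ceil_ge _) _.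
  rewrite [leRHS]pmulrn ler_int; set c := Num.ceil _; rewrite /K -/c.
  by apply: le_trans (ler_norm c) _; rewrite -abszE lez_nat.
(* [e / K] leaves room for the multiplication by [K]; the bounds 1 and [q / 2] give
   [cross r x ^+ 2 < q / 2]. *)
pose d := Num.min (e / K%:R) (Num.min 1 (q / 2)).
have d0 : 0 < d by rewrite !lt_min ltr01 !divr_gt0 //; lra.
have [z z0 zd] := small_linear_form (vec2 (- r 1 0) (r 0 0)) d0.
set x : 'cV[R]_2 := map_mx intr z in zd.
have xL : lattice x by exists z.
have xcross : dotp (vec2 (- r 1 0) (r 0 0)) x = cross r x.
  by rewrite dotp2 vec2_0 vec2_1 /cross; ring.
rewrite xcross !lt_min in zd; have /and3P[z1 z2 z3] := zd.
have xx : 1 <= dotp x x.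
  have : 0 < z 0 0 ^+ 2 + z 1 0 ^+ 2.
    have := @cv2_neq0 R x; rewrite !mxE -!rmorphXn -rmorphD /= ltr0z; apply.
    apply: contra z0 => /eqP/matrixP h; apply/eqP/matrixP => i j.
    by have /eqP := h i j; rewrite !mxE intr_eq0 => /eqP.
  by rewrite dotp2 -!expr2 !mxE -!rmorphXn -rmorphD /= -[leLHS]/(1%:~R) ler_int.
have big : q <= 4 * dotp r x ^+ 2.
  have := sqr_cross_dotp r x; rewrite -/q -(real_normK (num_real (cross r x))).
  have := normr_ge0 (cross r x); nra.
have K2 : L ^+ 2 <= (K%:R * `|dotp r x|) ^+ 2.
  by rewrite exprMn real_normK ?num_real //; nra.
have KL' : L <= K%:R * `|dotp r x|.
  have [L0|L0] := ltP L 0; first by rewrite ltW // (lt_le_trans L0) // mulr_ge0.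
  by rewrite -ler_sqr ?nnegrE // mulr_ge0.
have crossK : K%:R * `|cross r x| < e by rewrite mulrC -ltr_pdivlMr //; lra.
have crossZ c y : cross r (c *: y) = c * cross r y by rewrite /cross !mxE; ring.
have [rx|rx] := leP 0 (dotp r x).
  exists (K%:R *: x); split; first exact: (latticeZ (K : int)).
    by rewrite crossZ normrM normr_nat.
  by rewrite dotpZr -(ger0_norm rx).
exists (- (K%:R *: x)); split; first exact/latticeN/(latticeZ (K : int)).
  by rewrite -scaleNr crossZ normrM normrN normr_nat.
by rewrite dotpNr dotpZr -mulrN -(ltr0_norm rx).
Qed.

(** Integer steps [z] that go forward along [r] and change [cross r] by a small [h] can bring an
    integer point to within [|h| < e] of the ray from [x]. Irrationality is what makes [h]
    nonzero. *)
Lemma lattice_near_irrational_ray r x (e : R) : r != 0 -> 0 < e ->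
  (forall z, @lattice R z -> z != 0 -> cross r z != 0) ->
  exists y, [/\ lattice y, `|cross r y - cross r x| < e & dotp r x <= dotp r y].
Proof.
move=> r0 e0 irr; have q0 := dotp_self_gt0 r0.
have [z [zL ze z1]] := lattice_near_ray 1 r0 e0.
have z0 : z != 0 by apply/eqP => h; move: z1; rewrite h dotp0r ler10.
have := irr _ zL z0; set h := cross r z in ze * => h0.
pose s : R := Num.sg h.
pose B := `|r 0 0| + `|r 1 0|.
(* [p] is ahead of [x] and displaced sideways against the sign of [h]. Rounding [p] to [y] changes
   [dotp r] and [cross r] by at most [B] each, so [y] is not behind [x] and the number of steps [z]
   leading back to the ray is nonnegative. *)
pose p := x + (B / dotp r r) *: r - (s * B / dotp r r) *: vec2 (- r 1 0) (r 0 0).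
pose y : 'cV[R]_2 := map_mx intr (\col_i Num.floor (p i 0) : 'cV[int]_2).
have yL : lattice y by exists (\col_i Num.floor (p i 0)).
have pr : dotp r p = dotp r x + B.
  by rewrite dotpBr dotpDr !dotpZr divfK ?gt_eqF // dotp2 [dotp _ (vec2 _ _)]dotp2 vec2_0 vec2_1; ring.
have pc : cross r p = cross r x - s * B.
  transitivity (cross r x - s * B / dotp r r * dotp r r); last by rewrite divfK ?gt_eqF.
  by rewrite {1}/cross !mxE /= dotp2 /cross; ring.
have err i : 0 <= p i 0 - y i 0 < 1.
  have /andP[] := floor_itv (p i 0); rewrite rmorphD /= !mxE; lra.
have err_norm (a : R) i : `|a * (p i 0 - y i 0)| <= `|a|.
  by rewrite normrM ler_piMr // ler_norml; have := err i; lra.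
have yr : dotp r x <= dotp r y.
  have -> : dotp r y = dotp r p - (r 0 0 * (p 0 0 - y 0 0) + r 1 0 * (p 1 0 - y 1 0)).
    by rewrite !dotp2; ring.
  rewrite pr /B; have := err_norm (r 0 0) 0; have := err_norm (r 1 0) 1.
  by rewrite !ler_norml; lra.
have ye : `|cross r y - cross r p| <= B.
  have -> : cross r y - cross r p = r 1 0 * (p 0 0 - y 0 0) - r 0 0 * (p 1 0 - y 1 0).
    by rewrite /cross; ring.
  apply: le_trans (ler_normB _ _) _; rewrite /B.
  by have := err_norm (r 1 0) 0; have := err_norm (r 0 0) 1; lra.
have yc : 0 <= (cross r x - cross r y) / h.
  move: ye; rewrite pc ler_norml => /andP[h1 h2].
  have [hp|hn|hz] := ltrgtP 0 h; last by rewrite -hz eqxx in h0.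
    by rewrite divr_ge0 ?(ltW hp) //; move: h1 h2; rewrite /s gtr0_sg //; lra.
  rewrite -mulrNN -invrN divr_ge0 ?oppr_ge0 ?(ltW hn) //.
  by move: h1 h2; rewrite /s ltr0_sg //; lra.
pose k := Num.floor ((cross r x - cross r y) / h).
have /andP[k1 k2] := floor_itv ((cross r x - cross r y) / h).
exists (y + k%:~R *: z); split.
- by apply: latticeD => //; exact: latticeZ.
- have -> : cross r (y + k%:~R *: z) - cross r x =
      - (((cross r x - cross r y) / h - k%:~R) * h).
    rewrite mulrBl divfK // /h /cross !mxE; ring.
  rewrite normrN normrM; apply: le_lt_trans ze; rewrite ler_piMl // ler_norml.
  by move: k1 k2; rewrite -/k rmorphD /=; lra.
- rewrite dotpDr dotpZr; apply: le_trans yr _; rewrite lerDl mulr_ge0 //; last by lra.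
  by rewrite ler0z /k floor_ge0.
Qed.

(** Around an interior point [x], a short segment orthogonal to [r] lies in [W]. A point [y] of a
    thin strip about the ray is reached from the point [w] of this segment at the same [cross r]. *)
Lemma thick_ray (W : set 'cV[R]_2) x r : interior W x -> r != 0 ->
  exists2 e, 0 < e & forall y, `|cross r y - cross r x| < e -> dotp r x <= dotp r y ->
    exists2 w, W w & exists2 t, y = w + t *: r & t = (dotp r y - dotp r x) / dotp r r.
Proof.
move=> /nbhs_ballP[d /= d0 dW] r0; have q0 := dotp_self_gt0 r0.
set q := dotp r r in q0 *; pose B := `|r 0 0| + `|r 1 0| + 1.
have B0 : 0 < B by rewrite ltr_wpDl // addr_ge0.
exists (d * q / B) => [|y ye xy]; first by rewrite divr_gt0 ?mulr_gt0.
pose n := vec2 (- r 1 0) (r 0 0); pose c := (cross r y - cross r x) / q.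
have small i : `|c * n i 0| < d.
  have ni : `|n i 0| <= B.
    have : `|r 1 0| <= B /\ `|r 0 0| <= B.
      by rewrite /B; have := normr_ge0 (r 0 0); have := normr_ge0 (r 1 0); lra.
    by rewrite mxE; case: ifP => _; rewrite ?normrN => -[].
  rewrite normrM; apply: le_lt_trans (ler_wpM2l (normr_ge0 _) ni) _.
  by rewrite -ltr_pdivlMr // /c normrM normfV (gtr0_norm q0) ltr_pdivrMr // mulrAC.
exists (x + c *: n).
  apply: dW; split => // i j; rewrite ord1 /ball /= !mxE opprD addNKr normrN.
  by have := small i; rewrite mxE.
exists ((dotp r y - dotp r x) / q) => //.
have eq : q *: (y - x) = (dotp r y - dotp r x) *: r + (cross r y - cross r x) *: n.
  have := cross_decomposition r (y - x); rewrite -/q -/n dotpBr => ->.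
  by congr (_ + _ *: _); rewrite /cross !mxE; ring.
have : y - x = q^-1 *: (q *: (y - x)) by rewrite scalerA mulVf ?gt_eqF // scale1r.
rewrite eq scalerDr !scalerA ![q^-1 * _]mulrC -/c => /eqP; rewrite subr_eq => /eqP {1}->.
by rewrite addrC [_ *: r + _]addrC addrA.
Qed.

End Approximation.

(** * Integer points on rational lines and primitive normals *)

Section IntegerLines.
Variable R : realType.

Lemma perp_parallel (c r x : 'cV[R]_2) : c != 0 -> r != 0 ->
  dotp c r = 0 -> dotp c x = 0 -> exists t, x = t *: r.
Proof.
move=> c0 r0 cr cx; have q0 := dotp_self_gt0 r0.
exists (dotp r x / dotp r r).
have [s sc] : exists s, c = s *: vec2 (- r 1 0) (r 0 0).
  exists (cross r c / dotp r r).
  have := cross_decomposition r c; rewrite (dotpC r c) cr scale0r add0r => h.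
  by rewrite mulrC -scalerA -h scalerA mulVf ?gt_eqF // scale1r.
have s0 : s != 0 by apply: contra c0; rewrite sc => /eqP ->; rewrite scale0r.
have xr : cross r x = 0.
  apply: (mulfI s0); rewrite mulr0 -cx sc dotpZl; congr (_ * _).
  by rewrite dotp2 vec2_0 vec2_1 /cross; ring.
have := cross_decomposition r x; rewrite xr scale0r addr0 => h.
by rewrite mulrC -scalerA -h scalerA mulVf ?gt_eqF // scale1r.
Qed.

(** Bezout coefficients of the primitive [u] give an integer point [y0] on the line of [x], and the
    line is [y0] plus the real multiples of [v], the integral quarter turn of [u]. The coordinate
    [l] of [x] is then rounded in the direction of [r]. *)
Lemma integer_point_on_ray (u : 'cV[int]_2) (r x : 'cV[R]_2) (k : int) :
  vec_gcd u = 1 -> r != 0 -> dotp (map_mx intr u) r = 0 ->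
  dotp (map_mx intr u) x = k%:~R ->
  exists2 y, lattice y & exists2 t, 0 <= t & y = x + t *: r.
Proof.
move=> u1 r0 ur ux; have [a [b ab]] := Bezoutz (u 0 0) (u 1 0).
have {}ab : a * u 0 0 + b * u 1 0 = 1 by rewrite ab -u1.
have abR : a%:~R * (u 0 0)%:~R + b%:~R * (u 1 0)%:~R = 1 :> R.
  by rewrite -!intrM -intrD ab.
pose v : 'cV[R]_2 := map_mx intr (\col_i (if i == 0 then - u 1 0 else u 0 0) : 'cV[int]_2).
have vL : lattice v by eexists; reflexivity.
pose y0 : 'cV[R]_2 := map_mx intr (\col_i (if i == 0 then k * a else k * b) : 'cV[int]_2).
have y0L : lattice y0 by eexists; reflexivity.
have para d : dotp (map_mx intr u) d = 0 -> d = (a%:~R * d 1 0 - b%:~R * d 0 0) *: v.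
  rewrite dotp2 !mxE => h; apply: cv2P; rewrite !mxE /= ?rmorphN /=.
    transitivity ((a%:~R * (u 0 0)%:~R + b%:~R * (u 1 0)%:~R) * d 0 0 -
        a%:~R * ((u 0 0)%:~R * d 0 0 + (u 1 0)%:~R * d 1 0)); last by ring.
    by rewrite h abR mul1r mulr0 subr0.
  transitivity ((a%:~R * (u 0 0)%:~R + b%:~R * (u 1 0)%:~R) * d 1 0 -
      b%:~R * ((u 0 0)%:~R * d 0 0 + (u 1 0)%:~R * d 1 0)); last by ring.
  by rewrite h abR mul1r mulr0 subr0.
have uy0 : dotp (map_mx intr u) y0 = k%:~R.
  transitivity (k%:~R * (a%:~R * (u 0 0)%:~R + b%:~R * (u 1 0)%:~R) : R).
    by rewrite dotp2 !mxE /= !intrM; ring.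
  by rewrite abR mulr1.
have := para (x - y0); rewrite dotpBr ux uy0 subrr => /(_ erefl).
set l := (X in X *: v) => xy; have := para r ur; set s := (X in X *: v) => rs.
have s0 : s != 0 by apply: contra r0; rewrite rs => /eqP ->; rewrite scale0r.
(* [r = s *: v], so the sign of [s] decides which rounding moves forward along [r]. *)
pose j : int := if 0 < s then Num.ceil l else Num.floor l.
exists (y0 + j%:~R *: v); first by apply: latticeD => //; exact: latticeZ.
exists ((j%:~R - l) / s).
  rewrite /j; case: ltP => sp.
    by rewrite divr_ge0 ?(ltW sp) // subr_ge0 ceil_ge.
  by rewrite -mulrNN -invrN mulr_ge0 ?invr_ge0 ?oppr_ge0 // subr_le0 floor_le.
rewrite rs scalerA divfK // scalerBl -xy; apply/matrixP => i i'; rewrite !mxE; ring.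
Qed.

Lemma primitive_multiple (z : 'cV[int]_2) : z != 0 ->
  exists (u : 'cV[int]_2) (n : int), [/\ 0 < n, z = n *: u & vec_gcd u = 1].
Proof.
move=> z0; set n := gcdz (z 0 0) (z 1 0).
have n_ge0 : 0 <= n by [].
have n0 : n != 0.
  apply: contra z0; rewrite gcdz_eq0 => /andP[/eqP h0 /eqP h1].
  apply/eqP/matrixP => i j; rewrite ord1 mxE.
  case: (unliftP 0 i) => [l ->|-> //]; rewrite ord1 -[RHS]h1; congr (z _ _); exact: val_inj.
pose u : 'cV[int]_2 := \col_i divz (z i 0) n.
have zu : z = n *: u.
  apply/matrixP => i j; rewrite ord1 !mxE mulrC divzK //.
  case: (unliftP 0 i) => [l ->|->]; last exact: dvdz_gcdl.
  by rewrite ord1 (_ : lift 0 0 = 1 :> 'I_2); [exact: dvdz_gcdr|exact: val_inj].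
exists u, n; split=> //; first by rewrite lt_neqAle eq_sym n0.
have zE i : z i 0 = n * u i 0 by rewrite {1}zu mxE.
have : n * vec_gcd u = gcdz (z 0 0) (z 1 0) by rewrite !zE -mulz_gcdr gez0_abs.
by move=> /eqP; rewrite -/n -{2}[n]mulr1 (inj_eq (mulfI n0)) => /eqP.
Qed.

(** Bezout for the primitive [u] shows that [t] is an integer, and the gcd is homogeneous. This
    identifies the [tau] of a hyperbola cut with the factor between the asymptote's normal and the
    primitive one. *)
Lemma vec_gcd_scale (u z : 'cV[int]_2) (t : R) : vec_gcd u = 1 -> 0 < t ->
  map_mx intr z = t *: (map_mx intr u : 'cV[R]_2) -> (vec_gcd z)%:~R = t.
Proof.
move=> u1 t0 zt; have [a [b]] := Bezoutz (u 0 0) (u 1 0).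
rewrite -/(vec_gcd u) u1 => ab.
have zE i : (z i 0)%:~R = t * (u i 0)%:~R :> R.
  by have /matrixP/(_ i 0) := zt; rewrite !mxE.
have tE : t = (a * z 0 0 + b * z 1 0)%:~R.
  transitivity (t * (a * u 0 0 + b * u 1 0)%:~R); first by rewrite ab mulr1.
  by rewrite !intrD !intrM !zE; ring.
set n := _ + _ in tE; have n0 : 0 <= n by rewrite -(ler0z R) -tE ltW.
have zn i : z i 0 = n * u i 0 by apply: (@intr_inj R); rewrite zE tE intrM.
by rewrite /vec_gcd !zn -mulz_gcdr -/(vec_gcd u) u1 mulr1 gez0_abs.
Qed.

End IntegerLines.

(** * Recession directions of conic sections *)

Section Conics.
Variable R : realType.
Implicit Types (G : set 'cV[R]_2) (c r x : 'cV[R]_2).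

Lemma ler_sqrt_sqr (X y : R) : (Num.sqrt X <= y) <-> 0 <= y /\ X <= y ^+ 2.
Proof.
split=> [h|[y0 h]]; last by rewrite -[leRHS](ger0_norm y0) -sqrtr_sqr ler_wsqrtr.
have y0 : 0 <= y by apply: le_trans h; exact: sqrtr_ge0.
split=> //; have [X0|X0] := leP 0 X; last by rewrite (le_trans (ltW X0)) // sqr_ge0.
by rewrite -(sqr_sqrtr X0) ler_sqr ?nnegrE ?sqrtr_ge0.
Qed.

Definition recedes G r := forall x t, G x -> 0 <= t -> G (x + t *: r).

Lemma unitmx_mul_neq0 (T : 'M[R]_2) r : T \in unitmx -> r != 0 -> T *m r != 0.
Proof.
by move=> uT; apply: contra => /eqP h; rewrite -(mulKmx uT r) h mulmx0.
Qed.

Lemma affine_preimage (T : 'M[R]_2) (s y : 'cV[R]_2) : T \in unitmx ->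
  exists x, T *m x + s = y.
Proof. by move=> uT; exists (invmx T *m (y - s)); rewrite mulKVmx // subrK. Qed.

Lemma affinely_equivalent_point (C G : set 'cV[R]_2) r : affinely_equivalent C G -> r != 0 ->
  exists2 r', r' != 0 & forall y, exists2 x, G x <-> C y &
    forall t, G (x + t *: r) <-> C (y + t *: r').
Proof.
move=> [T uT [s ->]] r0; exists (T *m r); first exact: unitmx_mul_neq0.
move=> y; have [x xy] := affine_preimage s y uT.
exists x => [|t]; first by rewrite /= xy.
by rewrite /= mulmxDr -scalemxAr addrAC xy.
Qed.

Lemma ellipse_not_recedes G r : ellipse G -> recedes G r -> r = 0.
Proof.
move=> eG rec; apply/eqP/negPn/negP => r0.
have [r' r'0 /(_ 0)[x xP xr]] := affinely_equivalent_point eG r0.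
have Gx : G x by apply/xP; rewrite /= !mxE expr0n /= addr0 ler01.
have := cv2_neq0 r'0; set q := _ + _ => q0.
(* With [t * q = 2], the point at parameter [t + 2] has squared norm [2 * (t + 4) + 4 * q], which
   exceeds 1. *)
have [t t0 tq] : exists2 t, 0 < t & t * q = 2.
  by exists (2 / q); rewrite ?divr_gt0 // divfK ?gt_eqF.
have /xr := rec _ (t + 2) Gx (addr_ge0 (ltW t0) (ler0n _ _)).
rewrite add0r /= !mxE => h2; have : (t + 2) ^+ 2 * q <= 1 by rewrite /q; lra.
have : (t + 2) ^+ 2 * q = (t + 4) * (t * q) + 4 * q by ring.
rewrite tq; lra.
Qed.

(** In normal form a recession direction must be vertical. As [c] vanishes on it, [c] depends on the
    horizontal coordinate only, which takes every value on the parabola. *)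
Lemma parabola_unbounded G r c (l : R) : parabola G -> recedes G r -> r != 0 ->
  c != 0 -> dotp c r = 0 -> exists2 x, G x & dotp c x < l.
Proof.
move=> [T uT [s GE]] rec r0 c0 cr.
have := unitmx_mul_neq0 uT r0; have [r' r'E] : exists r', T *m r = r' by exists (T *m r).
rewrite r'E => r'0.
have [x0 x0s] := affine_preimage s 0 uT.
have Gx0 : G x0 by rewrite GE /= x0s !mxE expr0n /= lexx.
have ray t : 0 <= t -> (t * r' 0 0) ^+ 2 <= t * r' 1 0.
  move=> t0; have := rec _ _ Gx0 t0.
  by rewrite GE /= mulmxDr -scalemxAr addrAC x0s add0r r'E !mxE.
have r'00 : r' 0 0 = 0.
  apply/eqP/negPn/negP => h; have h2 : 0 < r' 0 0 ^+ 2 by rewrite exprn_even_gt0.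
  pose t := (`|r' 1 0| + 1) / r' 0 0 ^+ 2.
  have t0 : 0 < t by rewrite divr_gt0 // ltr_wpDl.
  have tE : t * r' 0 0 ^+ 2 = `|r' 1 0| + 1 by rewrite divfK ?gt_eqF.
  have := ray _ (ltW t0); rewrite exprMn [t ^+ 2]expr2 -mulrA tE ler_pM2l //.
  have := ler_norm (r' 1 0); clear=> h1 h2; lra.
have r'10 : r' 1 0 != 0.
  by apply: contra r'0 => /eqP h; apply/eqP/cv2P; rewrite mxE.
pose q := (invmx T)^T *m c.
have qE x : dotp c x = dotp q (T *m x).
  by rewrite dotp_mulmx /q mulmxA -trmx_mul mulVmx // trmx1 mul1mx.
have q1 : q 1 0 = 0.
  move: cr; rewrite qE r'E dotp2 r'00 mulr0 add0r => /eqP.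
  by rewrite mulf_eq0 (negPf r'10) orbF => /eqP.
have q0 : q 0 0 != 0.
  apply: contra c0 => /eqP h; apply/eqP.
  suff q0 : q = 0 by rewrite -(mul1mx c) -trmx1 -(mulVmx uT) trmx_mul -mulmxA -/q q0 mulmx0.
  by apply: cv2P; rewrite [RHS]mxE.
(* Chosen so that the point of the curve with abscissa [M] has objective value [l - 1]. *)
pose M := (l - 1 + dotp q s) / q 0 0.
have [x xE] := affine_preimage s (vec2 M (M ^+ 2)) uT.
exists x; first by rewrite GE /= xE !mxE.
have -> : dotp c x = dotp q (vec2 M (M ^+ 2)) - dotp q s by rewrite qE -dotpBr -xE addrK.
by rewrite [dotp q (vec2 _ _)]dotp2 vec2_0 vec2_1 q1 mul0r addr0 mulrC divfK //; clear; lra.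
Qed.

(** It is enough to test the steps [1] and [-1] from the vertex [(0, 1)] of the normal form. *)
Lemma hyperbola_no_line G r : nondegenerate_hyperbola_branch G ->
  (forall x t, G x -> G (x + t *: r)) -> r = 0.
Proof.
move=> hG line; apply/eqP/negPn/negP => r0.
have [r' r'0 /(_ (vec2 0 1))[x xP xr]] := affinely_equivalent_point hG r0.
have Gx : G x by apply/xP; rewrite /= !mxE /= expr0n add0r sqrtr1.
have ray t : (t * r' 0 0) ^+ 2 + 1 <= (1 + t * r' 1 0) ^+ 2 /\ 0 <= 1 + t * r' 1 0.
  by have /xr := line _ t Gx; rewrite /= !mxE /= add0r => /ler_sqrt_sqr[].
move: r'0; rewrite [r'](_ : _ = 0) ?eqxx //.
have [] := ray 1; have [] := ray (-1) => h1 h2 h3 h4.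
have r1 : r' 1 0 = 0 by nra.
by apply: cv2P; rewrite !mxE //; move: h1; rewrite r1; nra.
Qed.

(** The map [x -> 2 x - p] is the dilation by 2 about [p]. A pair of crossing lines is invariant
    under it at the crossing point, so this property rules out the degenerate case. *)
Lemma hyperbola_no_apex G p : nondegenerate_hyperbola_branch G -> G p ->
  ~ (forall x, G x -> G (2 *: x - p)).
Proof.
move=> [T uT [s ->]] /=; have [y yE] : exists y, T *m p + s = y by exists (T *m p + s).
rewrite yE => hp apex.
(* The point tested lies on the curve, one unit to the right of [p]. *)
pose d := y 0 0 + 1; pose e := Num.sqrt (d ^+ 2 + 1).
have [x xE] := affine_preimage s (vec2 d e) uT.
have := apex x; rewrite /= xE vec2_0 vec2_1 => /(_ (lexx _)).
have -> : T *m (2 *: x - p) + s = 2 *: vec2 d e - y.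
  by rewrite -xE -yE mulmxBr -scalemxAr; apply/matrixP => i j; rewrite !mxE; ring.
move: hp => /ler_sqrt_sqr[h1 h2]; rewrite !mxE /= => /ler_sqrt_sqr[h3 h4].
have e2 : e ^+ 2 = d ^+ 2 + 1 by rewrite sqr_sqrtr // ?addr_ge0 ?sqr_ge0.
have e0 : 0 <= e by exact: sqrtr_ge0.
move: h2 h4 h1 h3; rewrite (_ : y 0 0 = d - 1); last by rewrite /d addrK.
move: (y 1 0) => a h2 h4 h1 h3.
(* With [b = 2 e - a] the two memberships give
   [(a b)^2 >= ((d - 1)^2 + 1) ((d + 1)^2 + 1) = d^4 + 4], but [a + b = 2 e]
   forces [a b <= e^2 - 1 = d^2]. *)
pose b := 2 * e - a; have b0 : 0 <= b by rewrite /b; lra.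
have hb : (d + 1) ^+ 2 + 1 <= b ^+ 2 by apply: le_trans h4; rewrite lerD2r; lra.
have ab2 : ((d - 1) ^+ 2 + 1) * ((d + 1) ^+ 2 + 1) <= (a * b) ^+ 2.
  by rewrite exprMn; apply: ler_pM => //; rewrite addr_ge0 ?sqr_ge0.
have ab1 : a * b <= d ^+ 2.
  have : a + b = 2 * e by rewrite /b; ring.
  move=> hab; have : (a + b) ^+ 2 = 4 * (d ^+ 2 + 1) by rewrite hab exprMn e2; ring.
  nra.
have : (a * b) ^+ 2 <= (d ^+ 2) ^+ 2 by apply: lerXn2r ab1; rewrite nnegrE; [exact: mulr_ge0|exact: sqr_ge0].
move: ab2; clear; nra.
Qed.

(** * Hyperbola branches in the coordinates of their asymptotes *)

Section Asymptotes.
Variables (l0 l1 : 'cV[R]_2) (e0 e1 s : R) (G : set 'cV[R]_2).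
Hypothesis GP : forall x, G x <->
  [/\ s ^+ 2 <= (dotp l0 x - e0) * (dotp l1 x - e1), 0 <= dotp l0 x - e0 & 0 <= dotp l1 x - e1].
Hypothesis G_hyp : nondegenerate_hyperbola_branch G.

(** Otherwise some nonzero [y] is orthogonal to both normals, and [G] would contain whole lines of
    direction [y]. *)
Lemma asymptotes_independent : cross l0 l1 != 0.
Proof.
apply/negP => /eqP l01.
have [y y0 [ly0 ly1]] : exists2 y, y != 0 & dotp l0 y = 0 /\ dotp l1 y = 0.
  have perp (l l' : 'cV[R]_2) : l != 0 -> cross l l' = 0 ->
      exists2 y, y != 0 & dotp l y = 0 /\ dotp l' y = 0.
    move=> l_neq0 ll'; exists (vec2 (- l 1 0) (l 0 0)).
      apply: contra l_neq0 => /eqP/matrixP h; have := h 0 0; have := h 1 0.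
      rewrite vec2_0 vec2_1 !mxE => h1 /eqP; rewrite oppr_eq0 => /eqP h0.
      by apply/eqP/cv2P; rewrite mxE.
    by move: ll'; rewrite /cross !dotp2 vec2_0 vec2_1; split; lra.
  have [l00|l00] := eqVneq l0 0; last exact: perp l01.
  have [l10|l10] := eqVneq l1 0.
    exists (vec2 1 0); last by rewrite l00 l10 !dotp0l.
    by apply/eqP => /matrixP/(_ 0 0); rewrite vec2_0 mxE; apply/eqP/oner_neq0.
  have [|y y0 [h1 h0]] := perp l1 l0 l10; last by exists y.
  by rewrite l00 /cross !mxE; ring.
suff y00 : y = 0 by rewrite y00 eqxx in y0.
apply: (hyperbola_no_line G_hyp) => x t /GP h; apply/GP.
by rewrite !dotpDr !dotpZr ly0 ly1 mulr0 !addr0.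
Qed.

Lemma asymptotes_solve a0 a1 : exists x, dotp l0 x = a0 /\ dotp l1 x = a1.
Proof.
have D0 := asymptotes_independent; set D := cross l0 l1 in D0.
exists (D^-1 *: vec2 (l1 1 0 * a0 - l0 1 0 * a1) (l0 0 0 * a1 - l1 0 0 * a0)).
rewrite !dotpZr !dotp2 vec2_0 vec2_1.
split; apply: (mulfI D0); rewrite mulrA mulfV // mul1r /D /cross; ring.
Qed.

(** For [s = 0] the set is the cone between the asymptotes, invariant under the dilation about their
    crossing point. *)
Lemma hyperbola_offset_neq0 : s != 0.
Proof.
apply/eqP => s0; have [p [p0 p1]] := asymptotes_solve e0 e1.
apply: (@hyperbola_no_apex G p G_hyp).
  by apply/GP; rewrite p0 p1 !subrr s0 expr0n mulr0.
move=> x /GP[h1 h2 h3]; apply/GP; rewrite !dotpBr !dotpZr p0 p1.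
have -> (e d : R) : 2 * e - d - d = 2 * (e - d) by ring.
rewrite s0 in h1 *; split; [nra|lra|lra].
Qed.

Lemma hyperbola_gt_asymptote x : G x -> e0 < dotp l0 x /\ e1 < dotp l1 x.
Proof.
have s0 : 0 < s ^+ 2 by rewrite exprn_even_gt0 //= hyperbola_offset_neq0.
by move=> /GP[h1 h2 h3]; split; nra.
Qed.

Variables (c r : 'cV[R]_2) (al : R).
Hypotheses (c0 : c != 0) (r0 : r != 0) (cr : dotp c r = 0).
Hypotheses (lr0 : 0 <= dotp l0 r) (lr1 : 0 <= dotp l1 r).
Hypothesis c_ge : forall x, G x -> al <= dotp c x.

(** Write [c = k0 l0 + k1 l1]. Boundedness from below forces [k0, k1 >= 0]. Since [c r = 0] while
    [l0 r, l1 r >= 0] are not both zero, one coefficient vanishes and [c] is normal to an asymptote.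
    Points of [G] come arbitrarily close to that asymptote, so [al] bounds its level too. *)
Lemma hyperbola_supporting_direction :
  (exists2 t, 0 < t & l0 = t *: c /\ t * al <= e0) \/
  (exists2 t, 0 < t & l1 = t *: c /\ t * al <= e1).
Proof.
have D0 := asymptotes_independent.
have s2 : 0 < s ^+ 2 by rewrite exprn_even_gt0 //= hyperbola_offset_neq0.
have [k0 [k1 cE]] : exists k0 k1, c = k0 *: l0 + k1 *: l1.
  exists (cross c l1 / cross l0 l1), (cross l0 c / cross l0 l1).
  apply: cv2P; rewrite !mxE; apply: (mulfI D0); rewrite mulrDr !mulrA -!(mulrAC _ _ (cross l0 l1)^-1).
    by rewrite ![cross l0 l1 * _ * _ / _]mulrC !mulrA !mulVf // !mul1r /cross; ring.
  by rewrite ![cross l0 l1 * _ * _ / _]mulrC !mulrA !mulVf // !mul1r /cross; ring.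
have cx x : dotp c x = k0 * dotp l0 x + k1 * dotp l1 x by rewrite cE dotpDl !dotpZl.
have above a0 a1 : 0 <= a0 -> 0 <= a1 -> s ^+ 2 <= a0 * a1 ->
    al <= k0 * (e0 + a0) + k1 * (e1 + a1).
  move=> ha0 ha1 h; have [x [x0 x1]] := asymptotes_solve (e0 + a0) (e1 + a1).
  have -> : k0 * (e0 + a0) + k1 * (e1 + a1) = dotp c x by rewrite cx x0 x1.
  by apply: c_ge; apply/GP; rewrite x0 x1 !(addrC _ a0) !(addrC _ a1) !addrK.
have k00 : 0 <= k0.
  (* As [a >= 1], the point with asymptote coordinates [a] and [s ^+ 2] is in [G]; [a] is large
     enough to bring [c] below [al] there. *)
  rewrite leNgt; apply/negP => k0n; pose a := (`|al| + `|k0 * e0 + k1 * (e1 + s ^+ 2)|) / - k0 + 1.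
  have a1 : 1 <= a by rewrite lerDr divr_ge0 ?addr_ge0 // oppr_ge0 ltW.
  have ka : k0 * a = k0 - (`|al| + `|k0 * e0 + k1 * (e1 + s ^+ 2)|).
    by rewrite /a mulrDr mulr1 invrN mulrN mulrN mulrC divfK ?lt_eqF // addrC.
  have h : al <= k0 * (e0 + a) + k1 * (e1 + s ^+ 2) by apply: above; nra.
  have := ler_norm (- al); have := ler_norm (k0 * e0 + k1 * (e1 + s ^+ 2)); rewrite normrN.
  lra.
have k10 : 0 <= k1.
  rewrite leNgt; apply/negP => k1n; pose a := (`|al| + `|k1 * e1 + k0 * (e0 + s ^+ 2)|) / - k1 + 1.
  have a1 : 1 <= a by rewrite lerDr divr_ge0 ?addr_ge0 // oppr_ge0 ltW.
  have ka : k1 * a = k1 - (`|al| + `|k1 * e1 + k0 * (e0 + s ^+ 2)|).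
    by rewrite /a mulrDr mulr1 invrN mulrN mulrN mulrC divfK ?lt_eqF // addrC.
  have h : al <= k0 * (e0 + (s ^+ 2)) + k1 * (e1 + a) by apply: above; nra.
  have := ler_norm (- al); have := ler_norm (k1 * e1 + k0 * (e0 + s ^+ 2)); rewrite normrN.
  lra.
have := cr; rewrite cx => kr.
have lr_neq0 : dotp l0 r = 0 -> dotp l1 r = 0 -> False.
  move=> h0 h1; move: r0; rewrite [r](_ : _ = 0) ?eqxx //.
  move: h0 h1; rewrite !dotp2 => h0 h1.
  apply: cv2P; apply: (mulfI D0); rewrite mxE mulr0 /cross.
    transitivity (l1 1 0 * (l0 0 0 * r 0 0 + l0 1 0 * r 1 0) - l0 1 0 * (l1 0 0 * r 0 0 + l1 1 0 * r 1 0)); first by ring.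
    by rewrite h0 h1 !mulr0 subrr.
  transitivity (l0 0 0 * (l1 0 0 * r 0 0 + l1 1 0 * r 1 0) - l1 0 0 * (l0 0 0 * r 0 0 + l0 1 0 * r 1 0)); first by ring.
  by rewrite h0 h1 !mulr0 subrr.
have limit k e : 0 < k -> (forall d, 0 < d -> al <= k * (e + d)) -> k^-1 * al <= e.
  move=> kp h; rewrite mulrC ler_pdivrMr // leNgt; apply/negP => ek.
  have d0 : 0 < (al - e * k) / (2 * k) by rewrite divr_gt0 ?subr_gt0 // mulr_gt0.
  have := h _ d0; have : (al - e * k) / (2 * k) * (2 * k) = al - e * k.
    by rewrite divfK // mulf_neq0 // gt_eqF.
  by lra.
(* At distance [d] from one asymptote, the coordinate [s ^+ 2 / d] for the other keeps the point in
   [G]. *)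
have sd d : 0 < d -> s ^+ 2 <= s ^+ 2 / d * d by move=> d0; rewrite divfK ?gt_eqF.
have [k0z|k0z] := eqVneq k0 0.
  have k1p : 0 < k1.
    rewrite lt_neqAle k10 andbT eq_sym; apply: contra c0 => /eqP k1z.
    by rewrite cE k0z k1z !scale0r addr0.
  right; exists k1^-1; first by rewrite invr_gt0.
  split; first by rewrite cE k0z scale0r add0r scalerA mulVf ?gt_eqF // scale1r.
  apply: limit => // d d0; have := above (s ^+ 2 / d) d.
  by rewrite k0z mul0r add0r; apply; rewrite ?sd // ?divr_ge0 // ltW.
have k0p : 0 < k0 by rewrite lt_neqAle eq_sym k0z.
have h1 : 0 <= k1 * dotp l1 r by rewrite mulr_ge0.
have h0 : 0 <= k0 * dotp l0 r by rewrite mulr_ge0.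
have l0r : dotp l0 r = 0 by apply: (mulfI k0z); lra.
have k1z : k1 = 0.
  apply/eqP; apply: contraT => k1z; exfalso; apply: lr_neq0 => //.
  by apply: (mulfI k1z); lra.
left; exists k0^-1; first by rewrite invr_gt0.
split; first by rewrite cE k1z scale0r addr0 scalerA mulVf ?gt_eqF // scale1r.
apply: limit => // d d0; have := above d (s ^+ 2 / d).
by rewrite k1z mul0r addr0; apply; rewrite 1?[d * _]mulrC ?sd // ?divr_ge0 // ltW.
Qed.

End Asymptotes.
End Conics.

(** * Multipliers, rounding cuts and faces of the integer hull *)

Section Cuts.
Variable R : realType.

(** The difference of squares of the last two coordinates factors into the values of the two vectors
    [(0, 1, 1)] and [(0, -1, 1)]. *)
Lemma soc3P (v : 'cV[R]_3) : soc v <->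
  [/\ v 0 0 ^+ 2 <= dotp (asymptote_dual R 0) v * dotp (asymptote_dual R 1) v,
      0 <= dotp (asymptote_dual R 0) v & 0 <= dotp (asymptote_dual R 1) v].
Proof.
have dual (j : 'I_2) : dotp (asymptote_dual R j) v = (-1) ^+ j * v (lift ord_max 1) 0 + v ord_max 0.
  rewrite dotpE !big_ord_recr big_ord0 /= !mxE /= mul0r !add0r mul1r.
  by congr (_ * v _ 0 + _); exact: val_inj.
rewrite /soc /= !big_ord_recl big_ord0 addr0.
rewrite (_ : lift ord_max ord0 = 0 :> 'I_3); last exact: val_inj.
rewrite (_ : lift ord0 ord0 = 1 :> 'I_2); last exact: val_inj.
rewrite !dual expr0 expr1 mul1r mulN1r; move: (v 0 0) (v _ 0) (v ord_max 0) => a x y.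
split=> [/ler_sqrt_sqr[y0 h]|[h1 h2 h3]]; first by split; nra.
by apply/ler_sqrt_sqr; split; nra.
Qed.

Lemma asymptote_coefE (A : 'M[R]_(3, 2)) j : asymptote_coef A j = A^T *m asymptote_dual R j.
Proof. by apply/matrixP => l i; rewrite ord1 mxE dotp_col. Qed.

Lemma hyperbola_supporting_asymptote n (A : 'M[R]_(n.+1, 2)) b c r al :
  n = 2%N -> (forall l, A ord0 l = 0) ->
  nondegenerate_hyperbola_branch (conic_set (@soc R n) A b) ->
  r != 0 -> soc (A *m r) -> c != 0 -> dotp c r = 0 ->
  (forall x, conic_set (@soc R n) A b x -> al <= dotp c x) ->
  let b3 := three_rows b in
  exists (j : 'I_2) (t : R), [/\ 0 < t, asymptote_coef (three_rows A) j = t *: c,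
    b3 0 0 != 0, t * al <= dotp (asymptote_dual R j) b3 &
    forall x, conic_set (@soc R n) A b x ->
      dotp (asymptote_dual R j) b3 < t * dotp c x].
Proof.
move=> n2; subst n; rewrite /three_rows !conform_mx_id /= => A0 hyp r0 Kr c0 cr cb.
have Ax0 x : (A *m x) 0 0 = 0 by rewrite mxE big1 // => l _; rewrite A0 mul0r.
have AxE j x : dotp (asymptote_dual R j) (A *m x - b) =
    dotp (asymptote_coef A j) x - dotp (asymptote_dual R j) b.
  by rewrite dotpBr dotp_mulmx asymptote_coefE.
have GP x : conic_set (@soc R 2) A b x <->
    [/\ b 0 0 ^+ 2 <= (dotp (asymptote_coef A 0) x - dotp (asymptote_dual R 0) b) *
          (dotp (asymptote_coef A 1) x - dotp (asymptote_dual R 1) b),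
        0 <= dotp (asymptote_coef A 0) x - dotp (asymptote_dual R 0) b &
        0 <= dotp (asymptote_coef A 1) x - dotp (asymptote_dual R 1) b].
  rewrite -!AxE -sqrrN (_ : - b 0 0 = (A *m x - b) 0 0); first exact: soc3P.
  by rewrite [RHS]mxE Ax0 add0r mxE.
have [_] := (soc3P _).1 Kr; rewrite !dotp_mulmx -!asymptote_coefE => lr0 lr1.
have b0 := hyperbola_offset_neq0 GP hyp.
case: (hyperbola_supporting_direction GP hyp c0 r0 cr lr0 lr1 cb) => -[t t0 [lt h]].
  exists 0, t; split=> // x Gx; have [+ _] := hyperbola_gt_asymptote GP hyp Gx.
  by rewrite lt dotpZl.
exists 1, t; split=> // x Gx; have [_] := hyperbola_gt_asymptote GP hyp Gx.
by rewrite lt dotpZl.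
Qed.

Lemma bounded_line (al be ga : R) : (forall s, al <= be + s * ga) -> ga = 0.
Proof.
move=> h; apply/eqP/negPn/negP => g0.
by have := h ((al - be - 1) / ga); rewrite divfK //; lra.
Qed.

Definition perp (c : 'cV[R]_2) := vec2 (- c 1 0) (c 0 0).

Lemma dotp_perp c : dotp c (perp c) = 0.
Proof. by rewrite dotp2 vec2_0 vec2_1; ring. Qed.

Lemma perp_neq0 c : c != 0 -> perp c != 0.
Proof.
apply: contra => /eqP/matrixP h; have := h 0 0; have := h 1 0.
rewrite vec2_0 vec2_1 !mxE => h1 /eqP; rewrite oppr_eq0 => /eqP h0.
by apply/eqP/cv2P; rewrite mxE.
Qed.

(** A functional bounded below on a half-space is a positive multiple of its normal. A point at the
    level midway between [v] and [a] lies outside, so a dual [w] cuts it off; validity on the whole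
    half-space makes [A^T *m w] a multiple [k *: c], the cut forces [k > 0], and [w] is divided by
    [k]. *)
Lemma half_space_multiplier n (K : set 'cV[R]_n) (A : 'M[R]_(n, 2)) b c al :
  dually_closed K -> half_space (conic_set K A b) -> c != 0 ->
  (forall x, conic_set K A b x -> al <= dotp c x) ->
  exists a : R, (forall x, conic_set K A b x <-> a <= dotp c x) /\
    forall v, v < a ->
      exists w, [/\ dual_cone K w, A^T *m w = c & v < dotp w b <= a].
Proof.
move=> sK [[d e] /= d0 GE] c0 cal.
have GP x : conic_set K A b x <-> e <= dotp d x by rewrite GE.
clear GE.
have cc := dotp_self_gt0 c0; have dd := dotp_self_gt0 d0.
have at_level v : exists x, dotp c x = v.
  by exists ((v / dotp c c) *: c); rewrite dotpZr divfK ?gt_eqF.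
have cperp : dotp c (perp d) = 0.
  apply: (@bounded_line al (dotp c ((e / dotp d d) *: d))) => s.
  rewrite -dotpZr -dotpDr; apply: cal; apply/GP.
  by rewrite dotpDr !dotpZr dotp_perp mulr0 addr0 divfK ?gt_eqF.
have [t dE] : exists t, d = t *: c.
  apply: (@perp_parallel R (perp d)) => //; first exact: perp_neq0.
    by rewrite dotpC.
  by rewrite dotpC dotp_perp.
have t_neq0 : t != 0 by apply: contra d0 => /eqP tz; rewrite dE tz scale0r.
have t0 : 0 < t.
  rewrite lt_neqAle eq_sym t_neq0 /= leNgt; apply/negP => tn.
  have [x cx] := at_level (Num.min (e / t) (al - 1)).
  have := cal x; rewrite cx => h.
  have : al <= Num.min (e / t) (al - 1).
    apply: h; apply/GP; rewrite dE dotpZl cx mulrC -ler_ndivlMr //.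
    by rewrite ge_min lexx.
  by rewrite le_min => /andP[_]; lra.
pose a := e / t.
have GPc x : conic_set K A b x <-> a <= dotp c x.
  by rewrite GP dE dotpZl /a ler_pdivrMr // mulrC.
exists a; split=> // v va.
have [q cq] := at_level ((v + a) / 2).
have /(conic_set_cut sK)[w Kw wq] : ~ conic_set K A b q by move=> h; have := (GPc q).1 h; rewrite cq; lra.
set l := A^T *m w in wq.
have [x1 cx1] := at_level a.
have lperp : dotp l (perp c) = 0.
  apply: (@bounded_line (dotp w b) (dotp l x1)) => s.
  rewrite -dotpZr -dotpDr; apply: (conic_set_valid Kw); apply/GPc.
  by rewrite dotpDr dotpZr dotp_perp mulr0 addr0 cx1.
have [k lE] : exists k, l = k *: c.
  apply: (@perp_parallel R (perp c)) => //; first exact: perp_neq0.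
    by rewrite dotpC dotp_perp.
  by rewrite dotpC.
have wx1 : dotp w b <= k * a.
  by rewrite -cx1 -dotpZl -lE; apply: (conic_set_valid Kw); apply/GPc; rewrite cx1.
rewrite lE dotpZl cq in wq.
have k0 : 0 < k by nra.
exists (k^-1 *: w); split.
- by apply: dual_coneZ => //; rewrite invr_ge0 ltW.
- by rewrite -scalemxAr -/l lE scalerA mulVf ?gt_eqF // scale1r.
- rewrite dotpZl mulrC ltr_pdivlMr // ler_pdivrMr // mulrC [a * k]mulrC wx1 andbT.
  apply: lt_trans wq; nra.
Qed.

(* If every set went below level [al], moving far enough in the common
   recession direction [r] along a line [c x = const] would reach a common
   point there. *)
Lemma common_recession_bound m (G : 'I_m -> set 'cV[R]_2) c r x0 al :
  (forall i x y t, G i x -> G i y -> 0 <= t <= 1 -> G i (x + t *: (y - x))) ->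
  (forall i, recedes (G i) r) -> c != 0 -> r != 0 -> dotp c r = 0 ->
  (forall i, G i x0) -> (forall x, (forall i, G i x) -> al <= dotp c x) ->
  exists i, forall x, G i x -> al <= dotp c x.
Proof.
move=> Gconv Grec c0 r0 cr Gx0 cal; apply: contrapT => none.
have low i : exists x, G i x /\ dotp c x < al.
  apply: contrapT => h; apply: none; exists i => x Gx.
  by rewrite leNgt; apply/negP => cx; apply: h; exists x.
pose x i := projT1 (cid (low i)).
have xP i : G i (x i) /\ dotp c (x i) < al by exact: projT2 (cid (low i)).
(* The default [al - 1] keeps [k] below [al] even when there are no sets. *)
pose k := \big[Num.max/(al - 1)]_i dotp c (x i).
have k_al : k < al by apply: bigmax_lt => [|i _]; [lra|case: (xP i)].
have x_k i : dotp c (x i) <= k by exact: (le_bigmax (al - 1) (fun i => dotp c (x i)) i).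
have cc := dotp_self_gt0 c0; have x0al := cal _ Gx0.
pose p := (k / dotp c c) *: c.
have cp : dotp c p = k by rewrite dotpZr divfK ?gt_eqF.
(* The segment from [x i], at level at most [k], to the common point [x0], at level at least [al],
   crosses level [k] inside [G i]. *)
have on_line i : exists t, G i (p + t *: r).
  pose t := (k - dotp c (x i)) / (dotp c x0 - dotp c (x i)).
  have den : 0 < dotp c x0 - dotp c (x i) by have [_] := xP i; lra.
  pose y := x i + t *: (x0 - x i).
  have Gy : G i y.
    apply: Gconv => //; first by case: (xP i).
    apply/andP; split; first by rewrite divr_ge0 ?(ltW den) // subr_ge0 x_k.
    by rewrite ler_pdivrMr // mul1r; lra.
  have [|s ys] := @perp_parallel R c r (y - p) c0 r0 cr.
    by rewrite dotpBr cp dotpDr dotpZr dotpBr divfK ?gt_eqF //; ring.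
  by exists s; rewrite -ys addrC subrK.
pose t i := projT1 (cid (on_line i)).
have tP i : G i (p + t i *: r) by exact: projT2 (cid (on_line i)).
pose T := \sum_i `|t i|.
have : al <= dotp c (p + T *: r).
  apply: cal => i.
  have := Grec i _ (T - t i) (tP i); rewrite -addrA -scalerDl [t i + _]addrC subrK; apply.
  rewrite subr_ge0; apply: le_trans (ler_norm _) _.
  by apply: (@ler_sum_term _ _ (fun i => `|t i|)).
by rewrite dotpDr cp dotpZr cr mulr0 addr0 leNgt k_al.
Qed.

(** A Chvatal-Gomory cut: [g] is the ceiling of a single coordinate, odd at the columns of [A]
    because [w] takes integer values there. *)
Lemma ceil_lc_cut n (K : set 'cV[R]_n) (A : 'M[R]_(n, 2)) b w (u : 'cV[int]_2) :
  dual_cone K w -> A^T *m w = map_mx intr u ->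
  linear_composition_cut K A b (map_mx intr u, (Num.ceil (dotp w b))%:~R).
Proof.
move=> Kw Awu; have wA j : dotp w (col j A) = (u j 0)%:~R by rewrite dotp_col Awu mxE.
pose g (v : 'cV[R]_1) : R := (Num.ceil (v 0 0))%:~R.
exists (fun v => (Num.ceil (dotp w v))%:~R); last first.
  by congr pair; apply/matrixP => j i; rewrite ord1 !mxE wA intrKceil.
exists 1%N, (fun=> w), g; split=> // [|j|v]; rewrite /g.
- split=> [x y|x y xy|]; last by rewrite mxE ceil0.
    by rewrite -intrD ler_int ceil_le_int mxE rmorphD lerD ?ceil_ge.
  by rewrite ler_int le_ceil.
- by rewrite !mxE wA -[- (u j 0)%:~R]rmorphN /= !intrKceil rmorphN opprK.
- by rewrite mxE.
Qed.

Lemma linear_composition_cutZ n (K : set 'cV[R]_n) (A : 'M[R]_(n, 2)) b c t :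
  0 <= t -> linear_composition_cut K A b c ->
  linear_composition_cut K A b (t *: c.1, t * c.2).
Proof.
move=> t0 [f [p [w [g /= [p0 Kw [gD gle g0] godd fE]]]] ->].
exists (fun v => t * f v); last by congr pair; apply/matrixP => i j; rewrite !mxE.
exists p, w, (fun v => t * g v); split=> // [|j|v].
- split=> [x y|x y /gle xy|]; last by rewrite g0 mulr0.
    by rewrite -mulrDr ler_wpM2l.
  by rewrite ler_wpM2l.
- by rewrite {1}godd mulrN.
- by rewrite fE.
Qed.

(** A nonzero offset turns both branches of the definition into rounding to the next strictly larger
    integer. *)
Lemma f_gamma_offset (gamma v : 'cV[R]_3) : v 0 0 != 0 ->
  f_gamma gamma v = (Num.floor (dotp gamma v) + 1)%:~R.
Proof.
move=> v0; rewrite /f_gamma v0 /=; case: ifPn => h.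
  by rewrite intrD floorK.
by rewrite ceil_floor h.
Qed.

(** If no integer point of [X] attained [c0], the open half-plane [c0 < dotp c y] would be a convex
    set containing all of them, hence the hull, contradicting the point of the face. *)
Lemma integer_hull_face (X : set 'cV[R]_2) c (c0 : R) :
  defines_face (integer_hull X) (c, c0) ->
  (forall x, X x -> lattice x -> c0 <= dotp c x) /\
  exists x, [/\ X x, lattice x & dotp c x = c0].
Proof.
move=> [valid [x hx cx]].
have sub y : X y -> lattice y -> c0 <= dotp c y.
  by move=> Xy Ly; apply: valid => M [_]; apply.
split=> //; apply: contrapT => none.
have : [set y | c0 < dotp c y] x.
  apply: hx; split=> [|y [Xy Ly]] /=.
    apply/convex_setW => y z; rewrite !inE /= => hy hz l l0 l1.
    rewrite inE; change (c0 < dotp c (l%:num *: y + (1 - l%:num) *: z)).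
    rewrite dotpDr !dotpZr; have := l0; have := l1; nra.
  rewrite lt_neqAle sub // andbT eq_sym; apply/eqP => cy.
  by apply: none; exists y.
by rewrite /= in cx *; rewrite cx ltxx.
Qed.

End Cuts.

(** * Cuts for the intersection of the conic constraints *)

Section Main.
Variables (R : realType) (m : nat) (k : 'I_m -> nat).
Variables (A : forall i : 'I_m, 'M[R]_((k i).+1, 2)) (b : forall i : 'I_m, 'cV[R]_(k i).+1).
Variable W : set 'cV[R]_2.
Hypothesis W_def : W = \bigcap_(i in [set: 'I_m]) Wset A b i.
Hypothesis W_conic : forall i : 'I_m,
  half_space (Wset A b i) \/ conic_section (Wset A b i).
Hypothesis W_hyperbola : forall i : 'I_m, hyperbola_branch (Wset A b i) ->
  [/\ nondegenerate_hyperbola_branch (Wset A b i), k i = 2%N &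
      forall l : 'I_2, A i ord0 l = 0].
Hypothesis W_asymptotes : forall (i : 'I_m) (j : 'I_2),
  hyperbola_branch (Wset A b i) ->
  rational_direction (asymptote_coef (three_rows (A i)) j) ->
  integral_vec (asymptote_coef (three_rows (A i)) j).
Hypothesis W_nonredundant : forall j : 'I_m,
  W `<` \bigcap_(i in [set i : 'I_m | i != j]) Wset A b i.

Let K := @soc_prod R m k.
Let AA := \mxcol_i A i.
Let bb := \mxcol_i b i.
Let K_closed : dually_closed K := @soc_prod_dually_closed R m k.

Let WE x : W x <-> forall i, Wset A b i x.
Proof. by rewrite W_def; split=> [h i|h i _]; exact: h. Qed.

Let WP x : W x <-> conic_set K AA bb x.
Proof. exact: iff_trans (WE x) (Wset_prod A b x). Qed.

Let W_recedes r : K (AA *m r) -> recedes W r.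
Proof. by move=> Kr x t /WP Wx t0; apply/WP; exact: conic_set_recession. Qed.

Let Wset_recedes r i : K (AA *m r) -> recedes (Wset A b i) r.
Proof.
move=> /soc_prod_mxcol Kr x t Wx t0.
by apply: conic_set_recession => //; exact: soc_dually_closed.
Qed.

Let Wset_convex i x y t : Wset A b i x -> Wset A b i y -> 0 <= t <= 1 ->
  Wset A b i (x + t *: (y - x)).
Proof. by apply: conic_set_convex; exact: soc_dually_closed. Qed.

Lemma segment_level (c x y : 'cV[R]_2) v : dotp c x <= v <= dotp c y ->
  exists2 t, 0 <= t <= 1 & dotp c (x + t *: (y - x)) = v.
Proof.
move=> /andP[xv vy]; have [e|ne] := eqVneq (dotp c x) (dotp c y).
  by exists 0; rewrite ?lexx ?ler01 // scale0r addr0; apply/eqP; rewrite eq_le xv e vy.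
have d : 0 < dotp c y - dotp c x by rewrite subr_gt0 lt_neqAle ne (le_trans xv).
exists ((v - dotp c x) / (dotp c y - dotp c x)).
  by rewrite divr_ge0 ?(ltW d) ?subr_ge0 //= ler_pdivrMr // mul1r lerD2r.
by rewrite dotpDr dotpZr dotpBr divfK ?gt_eqF // addrC subrK.
Qed.

Let W_level c x y v : W x -> W y -> dotp c x <= v <= dotp c y ->
  exists2 z, W z & dotp c z = v.
Proof.
move=> /WE Wx /WE Wy /segment_level[t t01 tv].
by exists (x + t *: (y - x)) => //; apply/WE => i; exact: Wset_convex.
Qed.

Let W_integer_level (u : 'cV[int]_2) r x (n : int) : vec_gcd u = 1 -> r != 0 ->
  K (AA *m r) -> dotp (map_mx intr u) r = 0 -> W x ->
  dotp (map_mx intr u) x = n%:~R ->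
  exists y, [/\ W y, lattice y & dotp (map_mx intr u) y = n%:~R].
Proof.
move=> u1 r0 Kr ur Wx ux; have [y Ly [t t0 yE]] := integer_point_on_ray u1 r0 ur ux.
exists y; split=> //; first by rewrite yE; exact: W_recedes.
by rewrite yE dotpDr dotpZr ur mulr0 addr0.
Qed.

(** Only hyperbola cuts need the positive factor; linear composition cuts are themselves closed
    under scaling. *)
Definition is_cut (c : ineq R) : Prop :=
  system_lc_cut A b c \/ exists2 c', system_hyperbola_cut A b c' & same_ineq c c'.

(** Non-redundancy gives a point of all other sets below the level [a] of the half-space; the
    segment from it to [x0] meets level [a] in a point of [W]. So [n] is [a] rounded up. The last
    two conjuncts place [n] relative to the levels of [W] and later identify it. *)
Lemma half_space_cut i (u : 'cV[int]_2) x0 al :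
  let c : 'cV[R]_2 := map_mx intr u in
  half_space (Wset A b i) -> c != 0 -> W x0 ->
  (forall x, Wset A b i x -> al <= dotp c x) ->
  exists n : int, [/\ is_cut (c, n%:~R), exists2 s, W s & dotp c s <= n%:~R &
    forall s, W s -> n%:~R - 1 < dotp c s].
Proof.
move=> c hs c0 Wx0 cal.
have [a [aP aw]] := half_space_multiplier (@soc_dually_closed R (k i)) hs c0 cal.
have [z Wz cz] : exists2 z, W z & dotp c z = a.
  have [WW /existsNP[y /not_implyP[yW nWy]]] := W_nonredundant i.
  have other j : j != i -> Wset A b j y by move=> ji; apply: yW.
  have ya : dotp c y < a.
    rewrite ltNge; apply/negP => /aP Wy; apply: nWy; apply/WE => j.
    by have [->|] := eqVneq j i; [exact: Wy|exact: other].
  have Wx0' := (WE x0).1 Wx0.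
  have /segment_level[t t01 tv] : dotp c y <= a <= dotp c x0.
    by rewrite (ltW ya) /=; apply/aP; exact: Wx0'.
  exists (y + t *: (x0 - y)) => //; apply/WE => j.
  have [->|ji] := eqVneq j i; first by apply/aP; rewrite tv.
  by apply: Wset_convex => //; exact: other.
(* Any multiplier with value in the interval from [ceil a - 1], excluded, to [a] rounds up to
   [ceil a]. *)
have [|w [Kw wA /andP[w1 w2]]] := aw ((Num.ceil a)%:~R - 1).
  by have := ceilB1_lt a; rewrite rmorphB.
have wn : Num.ceil (dotp w (b i)) = Num.ceil a.
  apply: ceil_def; rewrite rmorphB /= w1 /=; apply: le_trans w2 _; exact: ceil_ge.
exists (Num.ceil a); split.
- left; rewrite -wn -(dotp_block_vec_mxcol b w); apply: ceil_lc_cut.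
    exact: block_vec_dual.
  by rewrite block_vec_mxcol.
- by exists z => //; rewrite cz ceil_ge.
- move=> s /WE/(_ i)/aP; apply: lt_le_trans.
  by have := ceilB1_lt a; rewrite rmorphB.
Qed.

(** With [al] approached by [W] and at most the asymptote's level [be / t], the set [W] reaches
    below every level greater than [be / t], while the branch stays strictly above [be / t]. *)
Lemma hyperbola_branch_cut i (u : 'cV[int]_2) r al :
  let c : 'cV[R]_2 := map_mx intr u in
  hyperbola_branch (Wset A b i) -> vec_gcd u = 1 -> c != 0 -> r != 0 ->
  K (AA *m r) -> dotp c r = 0 ->
  (forall x, Wset A b i x -> al <= dotp c x) ->
  (forall e, 0 < e -> exists2 s, W s & dotp c s < al + e) ->
  exists n : int, [/\ is_cut (c, n%:~R), exists2 s, W s & dotp c s <= n%:~R &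
    forall s, W s -> n%:~R - 1 < dotp c s].
Proof.
move=> c hyp u1 c0 r0 /soc_prod_mxcol Kr cr cal inf_al.
have [nd k2 A0] := W_hyperbola hyp.
have [j [t [t0 lt b0 tal gt]]] := hyperbola_supporting_asymptote k2 A0 nd r0 (Kr i) c0 cr cal.
have [|z zE] := W_asymptotes (j := j) hyp; first by exists t, u.
have gz : (vec_gcd z)%:~R = t by apply: (vec_gcd_scale u1) => //; rewrite -zE.
set be := dotp _ _ in tal gt.
(* Not the ceiling: when [be / t] is an integer, the strict inequality on the branch allows the next
   one, as in [f_gamma_offset]. *)
pose n := Num.floor (be / t) + 1.
have be_n : be / t < n%:~R by exact: floorD1_gt.
have n_be : n%:~R - 1 <= be / t by rewrite rmorphD /= addrK floor_le.
exists n; split.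
- right; exists (t *: c, t * n%:~R); last first.
    exists t^-1; first by rewrite invr_gt0.
    by rewrite /= scalerA mulrA mulVf ?gt_eqF // scale1r mul1r.
  exists i => //; exists j, z; split=> //.
  by rewrite lt gz f_gamma_offset // dotpZl [t^-1 * _]mulrC.
- have [|s Ws cs] := inf_al (n%:~R - be / t); first by rewrite subr_gt0.
  exists s => //; apply: ltW; apply: lt_le_trans cs _.
  have : al <= be / t by rewrite ler_pdivlMr // mulrC.
  lra.
- move=> s /WE/(_ i)/gt h; apply: le_lt_trans n_be _.
  by rewrite ltr_pdivrMr // mulrC.
Qed.

Lemma boundary_direction_cut (u : 'cV[int]_2) r x0 lb :
  let c : 'cV[R]_2 := map_mx intr u in
  vec_gcd u = 1 -> r != 0 -> K (AA *m r) -> dotp c r = 0 -> W x0 ->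
  (forall x, W x -> lb <= dotp c x) ->
  exists n : int, [/\ is_cut (c, n%:~R), exists2 s, W s & dotp c s <= n%:~R &
    forall s, W s -> n%:~R - 1 < dotp c s].
Proof.
move=> c u1 r0 Kr cr Wx0 clb.
have c0 : c != 0.
  apply/eqP => /matrixP h; have := h 0 0; have := h 1 0; rewrite !mxE.
  move=> /eqP; rewrite intr_eq0 => /eqP h1 /eqP; rewrite intr_eq0 => /eqP h0.
  by move: u1; rewrite /vec_gcd h0 h1.
pose E := [set dotp c x | x in W].
have Einf : has_inf E.
  by split; [exists (dotp c x0), x0|exists lb => _ [x Wx <-]; exact: clb].
have al_le x : W x -> inf E <= dotp c x.
  by move=> Wx; apply: ge_inf; [case: Einf|exists x].
have al_near e : 0 < e -> exists2 s, W s & dotp c s < inf E + e.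
  by move=> e0; have [_ [x Wx <-] h] := inf_adherent e0 Einf; exists x.
have [i ci] := common_recession_bound Wset_convex (fun i => @Wset_recedes r i Kr)
  c0 r0 cr ((WE x0).1 Wx0) (fun x h => al_le x ((WE x).2 h)).
case: (W_conic i) => [hs|[par|ell|hyp]].
- exact: half_space_cut hs c0 Wx0 ci.
- have [x /ci h1 h2] := parabola_unbounded (inf E) par (Wset_recedes Kr) r0 c0 cr.
  by move: h2; rewrite ltNge h1.
- by have := ellipse_not_recedes ell (Wset_recedes Kr) => /eqP; rewrite (negPf r0).
- exact: hyperbola_branch_cut hyp u1 c0 r0 Kr cr ci al_near.
Qed.

Lemma is_cut_scale (c : ineq R) t : 0 < t -> is_cut c -> is_cut (t *: c.1, t * c.2).
Proof.
move=> t0 [h|[c' h [s s0 ->]]]; first by left; apply: linear_composition_cutZ => //; exact: ltW.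
right; exists c' => //; exists (t * s); first exact: mulr_gt0.
by rewrite /= scalerA mulrA.
Qed.

Lemma is_cut_witness c : is_cut c -> exists2 c',
  system_lc_cut A b c' \/ system_hyperbola_cut A b c' &
  forall x, satisfies c' x -> satisfies c x.
Proof.
move=> [h|[c' h [t t0 ->]]]; first by exists c => //; left.
exists c'; first by right.
by move=> x; rewrite /satisfies /= dotpZl ler_pM2l.
Qed.

Hypothesis W_interior : interior W !=set0.

(** Without recession directions, one cut [0 >= G] with [G >= 1] is enough. An irrational direction
    would put an integer point in [W]. For a rational one, [W] lies strictly between two consecutive
    integer levels of the primitive normal [c], and the cuts for [c] and [- c] contradict each
    other. *)
Lemma lattice_free_certificate : W `&` @lattice R = set0 ->
  exists s : seq (ineq R),
    [/\ (size s <= 2)%N,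
        forall c : ineq R, c \in s -> system_lc_cut A b c \/ system_hyperbola_cut A b c &
        ~ exists x : 'cV[R]_2, forall c : ineq R, c \in s -> satisfies c x].
Proof.
move=> W0; have nW x : W x -> lattice x -> False.
  by move=> Wx Lx; have : (W `&` @lattice R) x by []; rewrite W0.
have [[r [r0 Kr]]|no_r] := pselect (exists r, r != 0 /\ K (AA *m r)); last first.
  have [r Kr r0|x Lx /WP Wx|G [G1 Gcut _]] := @lc_cut_of_positive R _ K K_closed AA bb 0 1.
  - by exfalso; apply: no_r; exists r.
  - by case: (nW x Wx Lx).
  exists [:: (map_mx intr 0, G)]; split=> // [c|[x]]; first by rewrite inE => /eqP ->; left.
  move=> /(_ _ (mem_head _ _)); rewrite /satisfies /= map_mx0 dotp0l.
  by rewrite leNgt (lt_le_trans ltr01 G1).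
have [x0 ix0] := W_interior; have Wx0 := interior_subset ix0.
have [[z [zL [z0 rz]]]|irr] := pselect (exists z, lattice z /\ z != 0 /\ cross r z = 0); last first.
  have [e e0 thick] := thick_ray ix0 r0.
  have [|y [Ly ye yr]] := @lattice_near_irrational_ray R r x0 e r0 e0.
    by move=> z zL z0; apply/eqP => rz; apply: irr; exists z.
  have [w Ww [t yE tE]] := thick y ye yr.
  case: (nW y) => //; rewrite yE; apply: W_recedes => //.
  by rewrite tE divr_ge0 ?subr_ge0 // ltW // dotp_self_gt0.
have [ze zE] := zL.
have ze0 : ze != 0 by apply: contra z0; rewrite zE => /eqP ->; rewrite map_mx0.
have [v [d [d0 zev v1]]] := primitive_multiple ze0.
(* The quarter turn of the primitive vector along [r], hence a primitive normal to [r]. *)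
pose u : 'cV[int]_2 := \col_i (if i == 0 then - v 1 0 else v 0 0).
have u1 : vec_gcd u = 1 by rewrite /vec_gcd !mxE /= gcdNz gcdzC.
have u1' : vec_gcd (- u) = 1 by rewrite /vec_gcd !mxE /= opprK gcdzN gcdzC.
pose c : 'cV[R]_2 := map_mx intr u.
have cN : map_mx intr (- u) = - c by rewrite map_mxN.
have cr : dotp c r = 0.
  have : d%:~R * dotp c r = - cross r z.
    by rewrite zE zev /cross dotp2 !mxE /= !intrM rmorphN; ring.
  by rewrite rz oppr0 => /eqP; rewrite mulf_eq0 intr_eq0 gt_eqF // => /eqP.
have no_level x (n : int) : W x -> dotp c x = n%:~R -> False.
  move=> Wx cx; have [y [Wy Ly _]] := W_integer_level u1 r0 Kr cr Wx cx.
  exact: nW Ly.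
pose n0 := Num.floor (dotp c x0).
have n0_le : n0%:~R <= dotp c x0 by exact: floor_le.
have lt_n0 : dotp c x0 < n0%:~R + 1 by have := floorD1_gt (dotp c x0); rewrite rmorphD.
have lower x : W x -> n0%:~R < dotp c x.
  move=> Wx; rewrite ltNge; apply/negP => cx.
  have [|z' Wz' cz'] := @W_level c x x0 n0%:~R Wx Wx0; first by rewrite cx n0_le.
  exact: no_level Wz' cz'.
have upper x : W x -> dotp c x < n0%:~R + 1.
  move=> Wx; rewrite ltNge; apply/negP => cx.
  have [|z' Wz' cz'] := @W_level c x0 x (n0%:~R + 1) Wx0 Wx; first by rewrite (ltW lt_n0).
  by apply: (@no_level z' (n0 + 1)) => //; rewrite cz' rmorphD.
have [|n [cut1 [s1 Ws1 hs1] _]] := @boundary_direction_cut u r x0 n0%:~R u1 r0 Kr cr Wx0.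
  by move=> x /lower /ltW.
have cr' : dotp (map_mx intr (- u)) r = 0 by rewrite cN dotpNl cr oppr0.
have [|n' [cut2 [s2 Ws2 hs2] _]] := @boundary_direction_cut (- u) r x0 (- (n0%:~R + 1)) u1' r0 Kr cr' Wx0.
  by move=> x /upper h; rewrite cN dotpNl lerN2 ltW.
(* [W] reaches a level at most [n] but lies above [n0]; with the symmetric bound for [n'], the two
   cuts read [c x >= n0 + 1] and [c x <= n0] or stronger. *)
have n_ge : n0%:~R + 1 <= n%:~R :> R.
  have : n0%:~R < n%:~R :> R by apply: lt_le_trans hs1; exact: lower.
  by rewrite ltr_int -lezD1 -(ler_int R) rmorphD.
have n'_ge : - n0%:~R <= n'%:~R :> R.
  have : - (n0 + 1)%:~R < n'%:~R :> R.
    apply: lt_le_trans hs2; rewrite cN dotpNl ltrN2 rmorphD; exact: upper.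
  rewrite -!rmorphN ltr_int ler_int; lia.
have [c1 c1cut c1P] := is_cut_witness cut1.
have [c2 c2cut c2P] := is_cut_witness cut2.
exists [:: c1; c2]; split=> // [e|[x xP]].
  by rewrite !inE => /orP[] /eqP ->.
have /c1P := xP c1 (mem_head _ _).
have c2_in : c2 \in [:: c1; c2] by rewrite !inE eqxx orbT.
have /c2P := xP c2 c2_in.
rewrite /satisfies /= cN dotpNl -/c; lra.
Qed.

(** If [c] vanishes on a recession direction, the cut at the boundary direction is shown to have the
    level of the face. Otherwise [c] is positive on all of them, since a direction with [c r < 0]
    would yield integer points of [W] of arbitrarily low objective. *)
Lemma face_cut (u : 'cV[int]_2) (c0 : R) :
  let c : 'cV[R]_2 := map_mx intr u in
  interior W `&` @lattice R !=set0 -> u != 0 ->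
  defines_face (integer_hull W) (c, c0) -> is_cut (c, c0).
Proof.
move=> c [x0 [ix0 Lx0]] u0 /integer_hull_face[valid [xs [Wxs Lxs cxs]]].
have Wx0 := interior_subset ix0.
have [[r [r0 Kr cr]]|no_r] := pselect (exists r, [/\ r != 0, K (AA *m r) & dotp c r = 0]).
  have [v [d [d0 uE v1]]] := primitive_multiple u0.
  pose c' : 'cV[R]_2 := map_mx intr v.
  have cE : c = d%:~R *: c' by rewrite /c uE map_mxZ.
  have d0' : 0 < d%:~R :> R by rewrite ltr0z.
  have c'r : dotp c' r = 0.
    by apply/eqP; have /eqP := cr; rewrite cE dotpZl mulf_eq0 gt_eqF.
  have [ks ksE] := dotp_lattice_int v Lxs; rewrite -/c' in ksE.
  have no_level x (n : int) : W x -> dotp c' x = n%:~R -> ks <= n.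
    move=> Wx cx; have [y [Wy Ly cy]] := W_integer_level v1 r0 Kr c'r Wx cx.
    have := valid y Wy Ly; rewrite -cxs cE !dotpZl ler_pM2l // ksE.
    by rewrite -/c' in cy; rewrite cy ler_int.
  (* Otherwise level [ks - 1] would meet [W], hence contain an integer point of [W] below the
     minimum [ks]. *)
  have bounded x : W x -> ks%:~R - 1 <= dotp c' x.
    move=> Wx; rewrite leNgt; apply/negP => cx.
    have [|y Wy cy] := @W_level c' x xs (ks - 1)%:~R Wx Wxs.
      by rewrite ksE ler_int rmorphB /= (ltW cx); lia.
    by have := no_level _ _ Wy cy; lia.
  have [n [cut [s Ws sn] n_lt]] := boundary_direction_cut v1 r0 Kr c'r Wxs bounded.
  (* Integrality turns the strict bound [n - 1 < ks] into [n <= ks]. *)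
  have n_ks : n <= ks.
    by have := n_lt _ Wxs; rewrite -/c' ksE -(rmorphB _ n 1) ltr_int; lia.
  have ks_n : ks <= n.
    have [|y Wy cy] := @W_level c' s xs n%:~R Ws Wxs; last exact: no_level cy.
    by rewrite sn ksE ler_int.
  have := is_cut_scale d0' cut.
  rewrite /= -/c' -cE (_ : d%:~R * n%:~R = c0) //.
  by rewrite -cxs cE dotpZl ksE (_ : n = ks) //; apply/eqP; rewrite eq_le n_ks.
have pos r : K (AA *m r) -> r != 0 -> 0 < dotp c r.
  move=> Kr r0; rewrite lt_neqAle eq_sym; apply/andP; split.
    by apply/eqP => cr; apply: no_r; exists r.
  rewrite leNgt; apply/negP => cr.
  have [e e0 thick] := thick_ray ix0 r0; have q0 := dotp_self_gt0 r0.
  set q := dotp r r in q0.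
  pose N := e * `|dotp c (vec2 (- r 1 0) (r 0 0))|.
  have N0 : 0 <= N by rewrite mulr_ge0 // ltW.
  (* An integer [z] near the ray with [dotp r z >= L] lowers [c] by at least [|dotp c x0 - c0| + 1],
     which takes [x0 + z] below [c0]; [N] bounds the contribution transverse to [r]. *)
  pose L := (N + q * (`|dotp c x0 - c0| + 1)) / - dotp c r.
  have L0 : 0 <= L.
    by rewrite divr_ge0 ?oppr_ge0 ?(ltW cr) // addr_ge0 // mulr_ge0 ?(ltW q0) // addr_ge0.
  have Lr : L * dotp c r = - (N + q * (`|dotp c x0 - c0| + 1)).
    by rewrite /L invrN mulrN mulNr divfK // lt_eqF.
  have [z [Lz ze zr]] := lattice_near_ray L r0 e0.
  have [||w Ww [t yE tE]] := thick (x0 + z).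
  - by rewrite (_ : cross r (x0 + z) - cross r x0 = cross r z) // /cross !mxE; ring.
  - by rewrite dotpDr lerDl (le_trans L0).
  have : W (x0 + z).
    rewrite yE; apply: W_recedes => //.
    by rewrite tE divr_ge0 ?(ltW q0) // dotpDr addrC addKr (le_trans L0).
  move=> /valid/(_ (latticeD Lx0 Lz)); apply/negP; rewrite -ltNge dotpDr.
  have : q * dotp c z = dotp r z * dotp c r + cross r z * dotp c (vec2 (- r 1 0) (r 0 0)).
    by rewrite -dotpZr cross_decomposition dotpDr !dotpZr.
  have : dotp r z * dotp c r <= L * dotp c r by rewrite ler_nM2r.
  have : cross r z * dotp c (vec2 (- r 1 0) (r 0 0)) <= N.
    apply: le_trans (ler_norm _) _; rewrite normrM ler_wpM2r //; exact: ltW.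
  rewrite Lr => h1 h2 h3.
  have : q * dotp c z <= q * - (`|dotp c x0 - c0| + 1) by lra.
  rewrite ler_pM2l //; have := ler_norm (dotp c x0 - c0); lra.
have [|G [c0G cut GP]] := @lc_cut_of_positive R _ K K_closed AA bb u c0 pos.
  by move=> x Lx /WP Wx; exact: valid.
(* The integer point [xs] attains [c0], so the valid bound [G >= c0] cannot be larger. *)
left; rewrite (_ : c0 = G); first exact: cut.
apply/eqP; rewrite eq_le c0G -cxs; apply: GP => //; exact/WP.
Qed.

End Main.

Theorem theorem3 (R : realType) (m : nat) (k : 'I_m -> nat)
    (A : forall i : 'I_m, 'M[R]_((k i).+1, 2))
    (b : forall i : 'I_m, 'cV[R]_(k i).+1)
    (W : set 'cV[R]_2)
    (W_def : W = \bigcap_(i in [set: 'I_m]) Wset A b i)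
    (W_interior : interior W !=set0)
    (W_conic : forall i : 'I_m,
      half_space (Wset A b i) \/ conic_section (Wset A b i))
    (W_hyperbola : forall i : 'I_m, hyperbola_branch (Wset A b i) ->
      [/\ nondegenerate_hyperbola_branch (Wset A b i),
          k i = 2%N &
          forall l : 'I_2, A i ord0 l = 0])
    (W_asymptotes : forall (i : 'I_m) (j : 'I_2),
      hyperbola_branch (Wset A b i) ->
      rational_direction (asymptote_coef (three_rows (A i)) j) ->
      integral_vec (asymptote_coef (three_rows (A i)) j))
    (W_nonredundant : forall j : 'I_m,
      W `<` \bigcap_(i in [set i : 'I_m | i != j]) Wset A b i) :
  (W `&` @lattice R = set0 ->
     exists s : seq (ineq R),
       [/\ (size s <= 2)%N,
           forall c : ineq R, c \in s ->
             system_lc_cut A b c \/ system_hyperbola_cut A b c &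
           ~ exists x : 'cV[R]_2, forall c : ineq R, c \in s -> satisfies c x])
  /\
  (interior W `&` @lattice R !=set0 ->
     forall (pi : 'cV[int]_2) (pi0 : R),
       pi != 0 ->
       defines_face (integer_hull W) (map_mx intr pi, pi0) ->
       system_lc_cut A b (map_mx intr pi, pi0) \/
       exists2 c : ineq R,
         system_hyperbola_cut A b c & same_ineq (map_mx intr pi, pi0) c).
Proof.
split; first exact: lattice_free_certificate.
by move=> W_lattice pi pi0; exact: face_cut.
Qed.
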